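(* Let $\Gamma$ be a finite simplicial graph such that the right-angled Artin group $A(\Gamma)$ is freely irreducible (i.e. does not split as a free product of two non-trivial groups), and let $H \leq A(\Gamma)$ be a Morse subgroup. Then either $H$ is a finite-index subgroup of $A(\Gamma)$, or $H$ is a free group all of whose non-trivial elements induce contracting isometries of $X(\Gamma)$.
   Context: $A(\Gamma)=\langle V(\Gamma) \mid [u,v]=1, \ \{u,v\} \in E(\Gamma)\rangle$. $X(\Gamma)$ denotes the Cayley graph of $A(\Gamma)$ with respect to the generating set $V(\Gamma)$, which is the one-skeleton of a CAT(0) cube complex (obtained by filling in the cubes, i.e. adding an $n$-cube along every induced subgraph isomorphic to the one-skeleton of an $n$-cube); it is endowed with the graph metric, and $A(\Gamma)$ acts on it by left multiplication. Morse subgroup: a subspace $Y$ of a geodesic metric space $X$ is a Morse subspace if, for every $A>0$ and $B \geq 0$, there exists $K \geq 0$ such that any $(A,B)$-quasigeodesic in $X$ between two points of $Y$ lies in the $K$-neighborhood of $Y$. A subgroup $H$ of a finitely generated group $G$ is a Morse subgroup if it is a Morse subspace in some (equivalently, any) Cayley graph of $G$ constructed from a finite generating set. Contracting isometry: a subspace $Y$ of a metric space $X$ is contracting if there exists $K \geq 0$ such that the nearest-point projection onto $Y$ of any ball disjoint from $Y$ has diameter at most $K$. An isometry $g$ of $X$ is contracting if there exists $x \in X$ such that $n \mapsto g^n \cdot x$ is a quasi-isometric embedding $\mathbb{Z} \to X$ and the orbit $\langle g \rangle \cdot x$ is contracting. *)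

(* Defs.v *)
From HB Require Import structures.
From mathcomp Require Import all_boot all_order all_algebra.
From mathcomp Require Import all_classical all_reals interval_inference.

Set Implicit Arguments.
Unset Strict Implicit.
Unset Printing Implicit Defensive.

Import Order.TTheory GRing.Theory Num.Theory.

Local Open Scope classical_set_scope.
Local Open Scope quotient_scope.

(** * Groups given by generators and relators *)

(* The letter (x, false) stands for x and (x, true) for its inverse. *)
Definition word (X : Type) := seq (X * bool).

Definition word_inv (X : Type) (w : word X) : word X :=
  rev [seq (a.1, ~~ a.2) | a <- w].

Section Presentation.
Variables (X : choiceType) (R : set (word X)).
Implicit Types u v w : word X.

Inductive word_eq : word X -> word X -> Prop :=
| word_eq_refl w : word_eq w w
| word_eq_sym w w' : word_eq w w' -> word_eq w' w
| word_eq_trans w w' w'' : word_eq w w' -> word_eq w' w'' -> word_eq w w''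
| word_eq_cancel u v x b : word_eq (u ++ [:: (x, b); (x, ~~ b)] ++ v) (u ++ v)
| word_eq_relator u v r : R r -> word_eq (u ++ r ++ v) (u ++ v).

Lemma word_eq_catl u w w' : word_eq w w' -> word_eq (u ++ w) (u ++ w').
Proof.
elim=> [w0|w1 w2 _|w1 w2 w3 _ IH1 _ IH2|u0 v x b|u0 v r Rr].
- exact: word_eq_refl.
- exact: word_eq_sym.
- exact: word_eq_trans IH1 IH2.
- by rewrite !(catA u u0); exact: word_eq_cancel.
- by rewrite !(catA u u0); exact: word_eq_relator.
Qed.

Lemma word_eq_catr u w w' : word_eq w w' -> word_eq (w ++ u) (w' ++ u).
Proof.
elim=> [w0|w1 w2 _|w1 w2 w3 _ IH1 _ IH2|u0 v x b|u0 v r Rr].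
- exact: word_eq_refl.
- exact: word_eq_sym.
- exact: word_eq_trans IH1 IH2.
- by rewrite -!catA; exact: word_eq_cancel.
- by rewrite -!catA; exact: word_eq_relator.
Qed.

Lemma word_invK : involutive (@word_inv X).
Proof.
move=> w; rewrite /word_inv map_rev revK -map_comp -[RHS]map_id.
by apply: eq_map => -[x b] /=; rewrite negbK.
Qed.

Lemma word_eq_invr w : word_eq (w ++ word_inv w) [::].
Proof.
elim/last_ind: w => [|w [x b] IH]; first exact: word_eq_refl.
rewrite /word_inv map_rcons rev_rcons -cats1 -catA.
exact: word_eq_trans (word_eq_cancel _ _ _ _) IH.
Qed.

Lemma word_eq_invl w : word_eq (word_inv w ++ w) [::].
Proof. by rewrite -{2}(word_invK w); exact: word_eq_invr. Qed.

Lemma word_eq_inv w w' : word_eq w w' -> word_eq (word_inv w) (word_inv w').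
Proof.
move=> ww'; apply: (@word_eq_trans _ (word_inv w ++ (w' ++ word_inv w'))).
  rewrite -{1}[word_inv w]cats0.
  exact/word_eq_catl/word_eq_sym/word_eq_invr.
rewrite -[X in word_eq _ X]cat0s catA; apply: word_eq_catr.
apply: word_eq_trans (word_eq_invl w).
exact/word_eq_catl/word_eq_sym.
Qed.

Definition word_eqb : rel (word X) := fun u v => `[< word_eq u v >].

Lemma word_eqb_refl : reflexive word_eqb.
Proof. by move=> w; apply/asboolP; exact: word_eq_refl. Qed.

Lemma word_eqb_sym : symmetric word_eqb.
Proof. by move=> u v; apply/asboolP/asboolP; exact: word_eq_sym. Qed.

Lemma word_eqb_trans : transitive word_eqb.
Proof.
by move=> v u w /asboolP uv /asboolP vw; apply/asboolP; exact: word_eq_trans vw.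
Qed.

Canonical word_equiv :=
  EquivRel word_eqb word_eqb_refl word_eqb_sym word_eqb_trans.

Definition presented_group := {eq_quot word_equiv}.

HB.instance Definition _ := Choice.on presented_group.

Definition pg_class (w : word X) : presented_group := \pi_{eq_quot word_equiv} w.
Definition pg_repr (a : presented_group) : word X :=
  repr (a : {eq_quot word_equiv}).

Lemma pg_reprK a : pg_class (pg_repr a) = a.
Proof. exact: reprK. Qed.

Lemma pg_classP u v : pg_class u = pg_class v <-> word_eq u v.
Proof.
split=> [/eqmodP|uv]; first by move/asboolP.
by apply/eqmodP/asboolP.
Qed.

Definition pg_one : presented_group := pg_class [::].
Definition pg_mul (a b : presented_group) : presented_group :=
  pg_class (pg_repr a ++ pg_repr b).
Definition pg_inv (a : presented_group) : presented_group :=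
  pg_class (word_inv (pg_repr a)).

Lemma pg_class_cat u v : pg_mul (pg_class u) (pg_class v) = pg_class (u ++ v).
Proof.
apply/pg_classP; apply: (@word_eq_trans _ (u ++ pg_repr (pg_class v))).
  by apply: word_eq_catr; apply/pg_classP; rewrite pg_reprK.
by apply: word_eq_catl; apply/pg_classP; rewrite pg_reprK.
Qed.

Lemma pg_class_inv u : pg_inv (pg_class u) = pg_class (word_inv u).
Proof.
by apply/pg_classP/word_eq_inv/pg_classP; rewrite pg_reprK.
Qed.

Lemma pg_mulA : associative pg_mul.
Proof.
move=> a b c; rewrite -(pg_reprK a) -(pg_reprK b) -(pg_reprK c).
by rewrite !pg_class_cat catA.
Qed.

Lemma pg_mul1 : left_id pg_one pg_mul.
Proof. by move=> a; rewrite -(pg_reprK a) pg_class_cat. Qed.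

Lemma pg_mulr1 : right_id pg_one pg_mul.
Proof. by move=> a; rewrite -(pg_reprK a) pg_class_cat cats0. Qed.

Lemma pg_mulV : left_inverse pg_one pg_inv pg_mul.
Proof.
move=> a; rewrite -(pg_reprK a) pg_class_inv pg_class_cat.
exact/pg_classP/word_eq_invl.
Qed.

Lemma pg_mulrV : right_inverse pg_one pg_inv pg_mul.
Proof.
move=> a; rewrite -(pg_reprK a) pg_class_inv pg_class_cat.
exact/pg_classP/word_eq_invr.
Qed.

HB.instance Definition _ :=
  isGroup.Build presented_group pg_mulA pg_mul1 pg_mulr1 pg_mulV pg_mulrV.

Definition pg_gen (x : X) : presented_group := pg_class [:: (x, false)].

End Presentation.

Definition free_group (X : choiceType) := presented_group (@set0 (word X)).
HB.instance Definition _ (X : choiceType) := Group.on (free_group X).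

(* The presentation < A, B | multiplication tables of A and of B >. *)
Definition free_product_relators (A B : groupType) : set (word (A + B)%type) :=
  [set w | (exists a a' : A, w = [:: (inl a, false); (inl a', false);
                                     (inl (a * a')%g, true)])
        \/ (exists b b' : B, w = [:: (inr b, false); (inr b', false);
                                     (inr (b * b')%g, true)])].

Definition free_product (A B : groupType) :=
  presented_group (@free_product_relators A B).
HB.instance Definition _ (A B : groupType) := Group.on (free_product A B).

Definition raag_relators (V : finType) (e : rel V) : set (word V) :=
  [set w | exists u v : V, e u v /\
     w = [:: (u, true); (v, true); (u, false); (v, false)]].

Definition raag (V : finType) (e : rel V) := presented_group (raag_relators e).
HB.instance Definition _ (V : finType) (e : rel V) := Group.on (raag e).

Definition raag_gen (V : finType) (e : rel V) (v : V) : raag e :=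
  pg_gen (raag_relators e) v.

Definition raag_gens (V : finType) (e : rel V) : set (raag e) :=
  range (@raag_gen V e).

Arguments raag_gen {V} e v.
Arguments raag_gens {V} e.

(** * Subgroups and free decompositions *)

Definition nontrivial (G : groupType) : Prop := exists g : G, g <> 1%g.

Definition freely_irreducible (G : groupType) : Prop :=
  ~ exists A B : groupType, [/\ nontrivial A, nontrivial B &
      exists f : {multiplicative free_product A B -> G}, bijective f].

Definition is_subgroup (G : groupType) (H : set G) : Prop :=
  H 1%g /\ forall x y, H x -> H y -> H (x / y)%g.

Definition generates (G : groupType) (S : set G) : Prop :=
  forall K : set G, is_subgroup K -> S `<=` K -> K = setT.

Definition finite_index (G : groupType) (H : set G) : Prop :=
  finite_set [set [set (g * h)%g | h in H] | g in [set: G]].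

Definition is_free_subgroup (G : groupType) (H : set G) : Prop :=
  exists (X : choiceType) (f : {multiplicative free_group X -> G}),
    injective f /\ range f = H.

Definition zpow (G : groupType) (g : G) (n : int) : G :=
  match n with Posz k => (g ^+ k)%g | Negz k => (g ^- k.+1)%g end.

Local Open Scope ring_scope.

(** * Metric notions; a metric on T is given by its distance d *)

Section Metric.
Variables (R : realType) (T : Type) (d : T -> T -> R).

Definition quasi_isometric_embedding (U : Type) (dU : U -> U -> R) (D : set U)
    (A B : R) (f : U -> T) : Prop :=
  forall s t, D s -> D t ->
    A^-1 * dU s t - B <= d (f s) (f t) /\ d (f s) (f t) <= A * dU s t + B.

Definition quasigeodesic (A B a b : R) (c : R -> T) : Prop :=
  a <= b /\ quasi_isometric_embedding (fun s t : R => `|s - t|)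
              [set t | a <= t <= b] A B c.

Definition morse_subspace (Y : set T) : Prop :=
  forall A B : R, 0 < A -> 0 <= B -> exists2 K : R, 0 <= K &
    forall (a b : R) (c : R -> T),
      quasigeodesic A B a b c -> Y (c a) -> Y (c b) ->
      forall t, a <= t <= b -> exists2 y, Y y & d (c t) y <= K.

Definition nearest_points (Y : set T) (p : T) : set T :=
  [set y | Y y /\ forall y', Y y' -> d p y <= d p y'].

Definition contracting (Y : set T) : Prop :=
  exists2 K : R, 0 <= K &
    forall (p : T) (r : R), (forall q, d p q <= r -> ~ Y q) ->
      forall q q' y y', d p q <= r -> d p q' <= r ->
        nearest_points Y q y -> nearest_points Y q' y' -> d y y' <= K.

(* The isometry is the one induced by g under an action [act] of G on T. *)
Definition contracting_isometry (G : groupType) (act : G -> T -> T) (g : G) :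
    Prop :=
  (forall p q, d (act g p) (act g q) = d p q) /\
  exists x : T,
    (exists A B : R, [/\ 0 < A, 0 <= B &
       quasi_isometric_embedding (fun m n : int => `|(m - n)%:~R|) setT A B
         (fun n => act (zpow g n) x)]) /\
    contracting [set act (zpow g n) x | n in [set: int]].

End Metric.

(** * Cayley graphs as metric graphs *)

Section Cayley.
Variables (R : realType) (G : groupType) (S : set G).

Definition cayley_adj : rel G :=
  fun g h => `[< exists2 s, S s & h = (g * s)%g \/ g = (h * s)%g >].

(* Length of a shortest edge path; junk value 0 if there is none. *)
Definition graph_dist (g h : G) : R :=
  inf [set (size p)%:R | p in [set p | path cayley_adj g p /\ last g p = h]].

(* [EdgePoint g s t] is the point at distance t from g on the unit edge from g
   to g * s.  A point may have several names (e.g. [Vertex g] and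
   [EdgePoint g s 0]); these are at distance 0 for [cayley_dist], which is
   thus only a pseudo-distance on names. *)
Inductive cayley_graph :=
| Vertex of G
| EdgePoint of G & {s : G | S s} & {i01 R}.

Definition edge_ends (p : cayley_graph) : set (G * R) :=
  match p with
  | Vertex g => [set (g, 0)]
  | EdgePoint g s t => [set (g, t%:num); ((g * sval s)%g, 1 - t%:num)]
  end.

Definition edge_lengths (p q : cayley_graph) : set R :=
  match p, q with
  | EdgePoint g s t, EdgePoint h s' t' =>
      [set r | [/\ g = h, sval s = sval s' & r = `|t%:num - t'%:num|]]
  | _, _ => set0
  end.

(* A shortest path from p to q either stays inside one edge or passes through
   an end of the edge of p and an end of the edge of q. *)
Definition cayley_dist (p q : cayley_graph) : R :=
  inf ([set a.2 + graph_dist a.1 b.1 + b.2 | a in edge_ends p & b in edge_ends q]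
       `|` edge_lengths p q).

Definition cayley_act (g : G) (p : cayley_graph) : cayley_graph :=
  match p with
  | Vertex h => Vertex (g * h)%g
  | EdgePoint h s t => EdgePoint (g * h)%g s t
  end.

End Cayley.

Arguments cayley_dist R {G} S p q.
Arguments cayley_act R {G} S g p.

Definition morse_subgroup (R : realType) (G : groupType) (H : set G) : Prop :=
  exists S : set G, [/\ finite_set S, generates S &
    morse_subspace (cayley_dist R S) [set Vertex R S h | h in H]].

(* Main.v *)
Require Import Defs.
From HB Require Import structures.
From mathcomp Require Import all_boot all_order all_algebra.
From mathcomp Require Import all_classical all_reals interval_inference.
From mathcomp Require Import zify lra.

(** The Cayley graph of a right-angled Artin group is studied through its
    hyperplanes. The hyperplane dual to an edge from [x] to [x * v] consists of
    the edges labelled [v] that start in the left coset of [x] by the subgroup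
    generated by the link of [v]. The parity of the number of times a path
    crosses a hyperplane depends only on the ends of the path ([parity_eq]), and
    a path that crosses a hyperplane twice can be shortened by two letters
    ([recross]). So word length counts separating hyperplanes ([size_hyps]), and
    Gromov products are counts of hyperplanes as well ([gromov_count]).

    Let H be a Morse subgroup. The group is freely irreducible, so its graph is
    connected ([irreducible_connected]). If an element of H and an element [u]
    commuting with it span a quasi-isometrically embedded plane, then three sides
    of large rectangles in this plane are quasigeodesics between points of H;
    powers of [u] therefore stay close to H, and some power of [u] lies in H
    ([morse_flat]). Suppose that a nontrivial element of H is conjugate to one
    whose support has a component of its complement graph adjacent to a common
    vertex. Then a power of a vertex lies in a conjugate of H. By connectedness
    the same is true for every vertex and every conjugate ([vertex_powers_conj]).
    So each point [x] lies on a line [x * v ^+ n] translated along itself by an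
    element of H; one more quasigeodesic, with constants independent of [x], shows
    that [x] is at bounded distance from H ([dense_of_vertex_powers]). Hence H
    has finite index ([join_finite_index]).

    Suppose now that H has infinite index. A nontrivial element of H is conjugate
    to some [c] of minimal length in its conjugacy class. The powers of a
    geodesic word for [c] are geodesic ([window_uniq]), and the translates of a
    hyperplane across this axis are strongly separated: no hyperplane crosses two
    of them that are far apart ([minimal_dichotomy]). Strong separation bounds
    the projection to the axis of balls disjoint from it
    ([strong_axis_contracting]), so [c] is contracting.

    Moreover H intersects trivially the conjugates of the subgroups generated by
    links of vertices. Order the vertices. The group is an iterated HNN extension
    with stable letters [v] centralising the subgroup generated by the earlier
    neighbours of [v]. Since H acts freely on the cosets of this subgroup, one
    edge labelled [v] can be chosen in each coset, equivariantly under H. The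
    chosen edges form a spanning tree of the Cayley graph: they are connected
    ([tree_connected]) and every labelling of them is a coboundary
    ([potential_exists]). So H acts freely on a tree and is free
    ([free_of_trivial_intersections]). *)

Set Implicit Arguments.
Unset Strict Implicit.
Unset Printing Implicit Defensive.

Import Order.TTheory GRing.Theory Num.Theory.

Local Open Scope classical_set_scope.
Local Open Scope group_scope.

(** * Homomorphisms out of a presented group *)

Section WordValue.
Variables (X : choiceType) (G : groupType) (phi : X -> G).
Implicit Types u v w : word X.

Definition letter_val (a : X * bool) : G :=
  if a.2 then (phi a.1)^-1 else phi a.1.

Definition word_val w : G := \prod_(a <- w) letter_val a.

Lemma word_val_nil : word_val [::] = 1.
Proof. exact: big_nil. Qed.

Lemma word_val_cons a w : word_val (a :: w) = letter_val a * word_val w.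
Proof. exact: big_cons. Qed.

Lemma word_val_cat u v : word_val (u ++ v) = word_val u * word_val v.
Proof. exact: big_cat. Qed.

Lemma word_val_eq (R : set (word X)) u v :
  (forall r, R r -> word_val r = 1) -> word_eq R u v -> word_val u = word_val v.
Proof.
move=> hR; elim=> [w|w w' _ ->|w w' w'' _ -> _ ->|u' v' x b|u' v' r Rr] //.
  rewrite !word_val_cat !word_val_cons word_val_nil mulg1 /letter_val /=.
  by case: b; rewrite /= ?mulVg ?mulgV ?mul1g.
by rewrite !word_val_cat (hR _ Rr) mul1g.
Qed.

End WordValue.

Section PresentedLift.
Variables (X : choiceType) (R : set (word X)) (G : groupType) (phi : X -> G).
Hypothesis hR : forall r, R r -> word_val phi r = 1.

(** The proof about the relators is an argument, so that the function
    determines its structure of morphism. *)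
Definition pg_lift of (forall r, R r -> word_val phi r = 1) :
  presented_group R -> G := fun a => word_val phi (pg_repr a).

Lemma pg_lift_class w : pg_lift hR (pg_class R w) = word_val phi w.
Proof. by apply: (word_val_eq hR); apply/pg_classP; rewrite pg_reprK. Qed.

Lemma pg_liftM : {morph pg_lift hR : a b / a * b}.
Proof.
move=> a b; rewrite -(pg_reprK a) -(pg_reprK b).
by rewrite [_ * _](pg_class_cat) !pg_lift_class word_val_cat.
Qed.

HB.instance Definition _ :=
  isMultiplicative.Build (presented_group R) G (pg_lift hR) pg_liftM.

Lemma pg_lift_gen x : pg_lift hR (pg_gen R x) = phi x.
Proof. by rewrite pg_lift_class word_val_cons word_val_nil mulg1. Qed.

End PresentedLift.

Lemma morph1 (G K : groupType) (f : G -> K) :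
  {morph f : x y / x * y} -> f 1 = 1.
Proof. by move=> fM; apply: (mulgI (f 1)); rewrite -fM !mulg1. Qed.

Lemma morphV (G K : groupType) (f : G -> K) :
  {morph f : x y / x * y} -> {morph f : x / x^-1}.
Proof.
by move=> fM x; apply: (mulgI (f x)); rewrite -fM !mulgV (morph1 fM).
Qed.

Lemma morph_word_val (X : choiceType) (G K : groupType) (f : G -> K) (phi : X -> G) w :
  {morph f : x y / x * y} -> f (word_val phi w) = word_val (f \o phi) w.
Proof.
move=> fM; elim: w => [|[x b] w IH]; first by rewrite !word_val_nil (morph1 fM).
rewrite !word_val_cons fM IH /letter_val; case: b => //=.
by rewrite (morphV fM).
Qed.

Lemma pg_class_val (X : choiceType) (R : set (word X)) w :
  pg_class R w = word_val (@pg_gen X R) w.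
Proof.
elim: w => [|[x b] w IH]; first by rewrite word_val_nil.
rewrite word_val_cons -IH -cat1s -pg_class_cat; congr (_ * _).
by case: b => //; rewrite /letter_val /= [RHS]pg_class_inv.
Qed.

Lemma pg_morph_ext (X : choiceType) (R : set (word X)) (K : groupType)
    (f g : presented_group R -> K) :
  {morph f : x y / x * y} -> {morph g : x y / x * y} ->
  (forall x, f (pg_gen R x) = g (pg_gen R x)) -> f =1 g.
Proof.
move=> fM gM fg a; rewrite -(pg_reprK a) pg_class_val.
rewrite (morph_word_val _ _ fM) (morph_word_val _ _ gM).
by rewrite /word_val; apply: eq_bigr => -[x []] _; rewrite /letter_val /= ?fg.
Qed.

(** * Word length and parabolic subgroups *)

Record simple_graph (V : finType) := SimpleGraph {
  adj :> rel V;
  adj_sym : symmetric adj;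
  adj_irr : irreflexive adj }.

Section Raag.
Variables (V : finType) (e : rel V).
Implicit Types (u v w : word V) (g h x y z : raag e) (S T : pred V).

Definition el w : raag e := pg_class (raag_relators e) w.

Lemma elP u v : el u = el v <-> word_eq (raag_relators e) u v.
Proof. exact: pg_classP. Qed.

Lemma el_nil : el [::] = 1.
Proof. by []. Qed.

Lemma el_cat u v : el (u ++ v) = el u * el v.
Proof. by rewrite [RHS](pg_class_cat). Qed.

Lemma el_cons a v : el (a :: v) = el [:: a] * el v.
Proof. by rewrite -cat1s el_cat. Qed.

Lemma el_inv w : el (word_inv w) = (el w)^-1.
Proof. by rewrite [RHS](pg_class_inv). Qed.

Lemma el_surj g : exists w, el w = g.
Proof. by exists (pg_repr g); rewrite /el pg_reprK. Qed.

Lemma el_letter (v : V) (b : bool) :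
  el [:: (v, b)] = if b then (raag_gen e v)^-1 else raag_gen e v.
Proof. by case: b => //; rewrite -[RHS]el_inv. Qed.

Lemma el_gen (v : V) : el [:: (v, false)] = raag_gen e v.
Proof. by []. Qed.

Lemma el_letterV (v : V) (b : bool) : (el [:: (v, b)])^-1 = el [:: (v, ~~ b)].
Proof. by rewrite !el_letter; case: b; rewrite ?invgK. Qed.

Lemma word_lenP g : exists n, `[< exists2 w, el w = g & size w = n >].
Proof.
by have [w <-] := el_surj g; exists (size w); apply/asboolP; exists w.
Qed.

Definition len g := ex_minn (word_lenP g).
Arguments len g%_group_scope.

Lemma geodesic_word g : exists2 w, el w = g & size w = len g.
Proof. by rewrite /len; case: ex_minnP => n /asboolP. Qed.

Lemma len_el w : (len (el w) <= size w)%N.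
Proof.
rewrite /len; case: ex_minnP => n _; apply; apply/asboolP.
by exists w.
Qed.

Lemma len1 : len 1 = 0%N.
Proof. by apply/eqP; rewrite -leqn0; exact: (len_el [::]). Qed.

Lemma lenM x y : (len (x * y) <= len x + len y)%N.
Proof.
have [u <- <-] := geodesic_word x; have [v <- <-] := geodesic_word y.
by rewrite -el_cat -size_cat len_el.
Qed.

Lemma lenV x : len x^-1 = len x.
Proof.
have le z : (len z^-1 <= len z)%N.
  have [u <- <-] := geodesic_word z; rewrite -el_inv.
  by rewrite (leq_trans (len_el _)) // /word_inv size_rev size_map.
by apply/eqP; rewrite eqn_leq le /= -{1}[x]invgK le.
Qed.

Lemma lenX x n : (len (x ^+ n) <= n * len x)%N.
Proof.
elim: n => [|n IH]; first by rewrite expg0 len1.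
by rewrite expgS (leq_trans (lenM _ _)) // mulSn leq_add2l.
Qed.

Lemma len_letter a : (len (el [:: a]) <= 1)%N.
Proof. exact: (len_el [:: a]). Qed.

Definition dist x y := len (x^-1 * y).
Arguments dist (x y)%_group_scope.

Lemma dist_xx x : dist x x = 0%N.
Proof. by rewrite /dist mulVg len1. Qed.

Lemma distC x y : dist x y = dist y x.
Proof. by rewrite /dist -lenV invgM invgK. Qed.

Lemma dist_triangle y x z : (dist x z <= dist x y + dist y z)%N.
Proof.
by rewrite /dist -[X in (len X <= _)%N](_ : x^-1 * y * (y^-1 * z) = _) ?lenM //
           mulgA mulgK.
Qed.

Lemma distMl h x y : dist (h * x) (h * y) = dist x y.
Proof. by rewrite /dist invgM -mulgA mulKg. Qed.

Lemma dist1 x : dist 1 x = len x.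
Proof. by rewrite /dist invg1 mul1g. Qed.

Definition ret_word S w : word V := [seq a <- w | S a.1].

Lemma ret_word_cat S u v : ret_word S (u ++ v) = ret_word S u ++ ret_word S v.
Proof. exact: filter_cat. Qed.

(** Deleting the letters outside S turns a commutator relator into a relator,
    a pair of cancelling letters or the empty word. *)
Lemma ret_word_eq S u v : word_eq (raag_relators e) u v ->
  word_eq (raag_relators e) (ret_word S u) (ret_word S v).
Proof.
elim=> [w|w w' _|w w' w'' _ IH1 _ IH2|u' v' x b|u' v' r].
- exact: word_eq_refl.
- exact: word_eq_sym.
- exact: word_eq_trans IH1 IH2.
- rewrite !ret_word_cat /=; case: (S x); last exact: word_eq_refl.
  exact: word_eq_cancel.
move=> [x [y [xy ->]]]; rewrite !ret_word_cat /=.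
case Sx: (S x); case Sy: (S y); last exact: word_eq_refl.
- by apply: word_eq_relator; exists x, y.
- exact: (word_eq_cancel _ _ _ x true).
- exact: (word_eq_cancel _ _ _ y true).
Qed.

Definition ret S g : raag e := el (ret_word S (pg_repr g)).

Lemma ret_el S w : ret S (el w) = el (ret_word S w).
Proof. by apply/elP/ret_word_eq/elP; rewrite /el pg_reprK. Qed.

Lemma retM S : {morph ret S : x y / x * y}.
Proof.
move=> x y; have [u <-] := el_surj x; have [v <-] := el_surj y.
by rewrite -el_cat !ret_el ret_word_cat el_cat.
Qed.

Lemma retX S x n : ret S (x ^+ n) = ret S x ^+ n.
Proof.
elim: n => [|n IH]; first by rewrite !expg0 (morph1 (retM S)).
by rewrite !expgS retM IH.
Qed.

Lemma len_ret S g : (len (ret S g) <= len g)%N.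
Proof.
have [u <- <-] := geodesic_word g.
by rewrite ret_el (leq_trans (len_el _)) // size_filter count_size.
Qed.

(** The subgroup generated by the vertices in S, as the image of the
    retraction killing the other vertices. *)
Definition parab S : set (raag e) := [set g | ret S g = g].

Lemma parab_el S w : all (fun a => S a.1) w -> parab S (el w).
Proof. by rewrite /parab /= ret_el /ret_word => /all_filterP ->. Qed.

Lemma parab_word S g : parab S g ->
  exists2 w, el w = g & all (fun a => S a.1) w.
Proof.
move=> Sg; have [w wg] := el_surj g; exists (ret_word S w); last exact: filter_all.
by rewrite -ret_el wg.
Qed.

(** Otherwise the retraction would shorten the word. *)
Lemma parab_geodesic S w : parab S (el w) -> len (el w) = size w ->
  all (fun a => S a.1) w.
Proof.
move=> Sw lw; rewrite all_count; apply/eqP; apply/anti_leq; rewrite count_size /=.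
by rewrite -[X in (X <= _)%N]lw -Sw ret_el -size_filter len_el.
Qed.

Lemma parab1 S : parab S 1.
Proof. exact: (@parab_el S [::]). Qed.

Lemma parabM S x y : parab S x -> parab S y -> parab S (x * y).
Proof. by rewrite /parab /= retM => -> ->. Qed.

Lemma parabV S x : parab S x -> parab S x^-1.
Proof. by rewrite /parab /= (morphV (retM S)) => ->. Qed.

Lemma parabX S x n : parab S x -> parab S (x ^+ n).
Proof. by rewrite /parab /= retX => ->. Qed.

Lemma parab_letter S a : S a.1 -> parab S (el [:: a]).
Proof. by move=> Sa; apply: parab_el; rewrite /= Sa. Qed.

Lemma ret_disjoint S T g : (forall v : V, S v -> ~~ T v) -> parab S g -> ret T g = 1.
Proof.
move=> ST /parab_word [w <- Sw]; rewrite ret_el.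
suff -> : ret_word T w = [::] by [].
elim: w Sw => //= a w IH /andP[/ST /negbTE ->]; exact: IH.
Qed.

Lemma commute_letter (u v : V) b c : e u v ->
  commute (el [:: (u, b)]) (el [:: (v, c)]).
Proof.
move=> uv; have cuv : commute (raag_gen e u) (raag_gen e v).
  have : el [:: (u, true); (v, true); (u, false); (v, false)] = el ([::] ++ [::]).
    apply/elP; rewrite -[X in word_eq _ X _]cats0 -[X in word_eq _ (X ++ _)]cat0s.
    by rewrite -catA; apply: word_eq_relator; exists u, v.
  rewrite el_cons (el_cons (v, true)) (el_cons (u, false)) !el_letter /= => h.
  apply: (mulgI (raag_gen e v)^-1); apply: (mulgI (raag_gen e u)^-1).
  by rewrite h !mulgA mulgVK mulVg.
rewrite !el_letter; case: b; case: c => //.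
- by apply/commuteV/commute_sym/commuteV/commute_sym.
- exact/commute_sym/commuteV/commute_sym.
- exact/commuteV.
Qed.

Lemma commute_parab S T x y : (forall u v : V, S u -> T v -> e u v) ->
  parab S x -> parab T y -> commute x y.
Proof.
move=> ST /parab_word [u <- Su] /parab_word [v <- Tv].
elim: u Su => [|a u IHu] /=; first by move=> _; apply/commute_sym/commute1.
move=> /andP[Sa /IHu {}IHu]; rewrite el_cons; apply/commute_sym/commuteM; last first.
  exact/commute_sym.
elim: v Tv {IHu} => [|b v IHv] /=; first by move=> _; apply/commute_sym/commute1.
move=> /andP[Tb /IHv {}IHv]; rewrite el_cons.
apply/commute_sym/commuteM; last exact/commute_sym.
by case: a Sa {IHv} => ? ? Sa; case: b Tb => ? ? Tb; apply/commute_letter/ST.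
Qed.

End Raag.

Arguments el {V e} w.
Arguments parab {V e} S.
Arguments len {V e} g%_group_scope.
Arguments dist {V e} (x y)%_group_scope.
Arguments ret {V e} S g%_group_scope.

(** * Hyperplanes *)

Section Hyperplanes.
Variables (V : finType) (e : simple_graph V).
Implicit Types (w m t : word V) (a b : V * bool) (g h x y z p : raag e).
Implicit Types (S T : pred V).

(** A hyperplane is given by its label and by the coset formed by the initial
    points of the edges dual to it. *)
Definition hyperplane := (V * set (raag e))%type.
HB.instance Definition _ := Choice.copy hyperplane (V * set (raag e))%type.
Implicit Types J K : hyperplane.

(** The initial point of the edge that leaves [x] along [a], once it is oriented
    along its generator. *)
Definition edge_base x a := if a.2 then x * el [:: a] else x.

Definition coset S x : set (raag e) := [set y | parab S (x^-1 * y)].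

Definition dual x a : hyperplane := (a.1, coset (e a.1) (edge_base x a)).

Lemma coset_refl S x : coset S x x.
Proof. by rewrite /coset /= mulVg; exact: parab1. Qed.

Lemma coset_eq S x y : coset S x y <-> coset S x = coset S y.
Proof.
split=> [xy|->]; last exact: coset_refl.
apply/seteqP; split=> z; rewrite /coset /= => h.
  have -> : y^-1 * z = (x^-1 * y)^-1 * (x^-1 * z) by rewrite invgM invgK mulgA mulgK.
  by apply: parabM => //; apply: parabV.
have -> : x^-1 * z = (x^-1 * y) * (y^-1 * z) by rewrite mulgA mulgK.
exact: parabM.
Qed.

Lemma dualP x a y b :
  dual x a = dual y b <-> a.1 = b.1 /\ coset (e a.1) (edge_base x a) (edge_base y b).
Proof.
split=> [[-> cE]|[ab /coset_eq cE]]; first by split=> //; apply/coset_eq.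
by rewrite /dual -ab cE.
Qed.

Fixpoint crossings x w : seq hyperplane :=
  if w is a :: w' then dual x a :: crossings (x * el [:: a]) w' else [::].

Lemma crossings_cons x a w :
  crossings x (a :: w) = dual x a :: crossings (x * el [:: a]) w.
Proof. by []. Qed.

Lemma size_crossings x w : size (crossings x w) = size w.
Proof. by elim: w x => //= a w IH x; rewrite IH. Qed.

Lemma crossings_cat x w t :
  crossings x (w ++ t) = crossings x w ++ crossings (x * el w) t.
Proof.
elim: w x => [|a w IH] x /=; first by rewrite mulg1.
by rewrite IH (el_cons _ a w) mulgA.
Qed.

Lemma crossings_label x w J : J \in crossings x w -> J.1 \in [seq a.1 | a <- w].
Proof.
elim: w x => //= a w IH x; rewrite !inE => /orP[/eqP ->|/IH ->]; first by rewrite eqxx.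
by rewrite orbT.
Qed.

Definition parity J x w := odd (count_mem J (crossings x w)).

Lemma parity_cat J x w t :
  parity J x (w ++ t) = parity J x w (+) parity J (x * el w) t.
Proof. by rewrite /parity crossings_cat count_cat oddD. Qed.

Lemma dual_rev x (v : V) (b : bool) : dual (x * el [:: (v, b)]) (v, ~~ b) = dual x (v, b).
Proof.
rewrite /dual /edge_base /=; case: b => //=.
by rewrite -(el_letterV _ v false) mulgK.
Qed.

Lemma el_relator r : raag_relators e r -> @el V e r = 1.
Proof.
move=> Rr; apply/elP; rewrite -[X in word_eq _ X _]cats0.
by apply: word_eq_sym; apply: word_eq_sym; exact: (word_eq_relator [::] [::] Rr).
Qed.

(** Opposite edges of a commutation square are dual to the same hyperplane, so
    the boundary of the square crosses each hyperplane an even number of times. *)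
Lemma parity_eq J x w t : word_eq (raag_relators e) w t -> parity J x w = parity J x t.
Proof.
elim=> {w t}[|w t _ -> //|w t s _ -> _ -> //|w t v b|w t r Rr] //.
  rewrite !parity_cat [in LHS](_ : x * _ * _ = x * el w).
    by rewrite {2}/parity /= dual_rev addnA addn0 addnn odd_double addFb.
  rewrite (el_cons _ (v, b)) -mulgA -el_letterV; congr (_ * _).
  by rewrite mulgV mulg1.
rewrite !parity_cat (el_relator Rr) mulg1.
suff -> : parity J (x * el w) r = false by rewrite addFb.
case: Rr => u [v [uv ->]]; move: (x * el w) => y.
rewrite /parity /= (_ : dual y (u, true) =
    dual (y * el [:: (u, true)] * el [:: (v, true)]) (u, false)); last first.
  apply/dualP; split=> //; rewrite /coset /edge_base /= mulKg.
  exact: parab_letter.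
rewrite (_ : dual (y * el [:: (u, true)]) (v, true) =
    dual (y * el [:: (u, true)] * el [:: (v, true)] * el [:: (u, false)]) (v, false)); last first.
  apply/dualP; split=> //; rewrite /coset /edge_base /= mulKg.
  by apply: parab_letter; rewrite /= adj_sym.
by lia.
Qed.

(** [x] and [y] lie on different sides of [J]; by [sep_el] any path between them
    may be used to decide it. *)
Definition sep J x y := parity J x (pg_repr (x^-1 * y)).

Lemma sep_el J x w : sep J x (x * el w) = parity J x w.
Proof. by apply: parity_eq; apply/elP; rewrite mulKg /el pg_reprK. Qed.

Lemma mul_el x y : exists w, y = x * el w.
Proof. by have [w wE] := el_surj (x^-1 * y); exists w; rewrite wE mulVKg. Qed.

Lemma sep_trans y J x z : sep J x z = sep J x y (+) sep J y z.
Proof.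
have [w ->] := mul_el x y; have [t ->] := mul_el (x * el w) z.
by rewrite sep_el sep_el -mulgA -el_cat sep_el parity_cat.
Qed.

Lemma sep_xx J x : sep J x x = false.
Proof. by rewrite -[X in sep _ _ X]mulg1 -(el_nil e) sep_el. Qed.

Lemma sepC J x y : sep J x y = sep J y x.
Proof.
by apply/eqP; have := sep_trans y J x x; rewrite sep_xx; do 2!case: sep.
Qed.

Lemma sep_edge J x a : sep J x (x * el [:: a]) = (J == dual x a).
Proof. by rewrite sep_el /parity /= addn0 oddb eq_sym. Qed.

Lemma sep_real J x y : sep J x y -> exists z a, J = dual z a.
Proof.
have [w ->] := mul_el x y; rewrite sep_el /parity.
elim: w x => //= a w IH x; rewrite oddD oddb.
by case: eqP => [<- _|_ /= /IH //]; exists x, a.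
Qed.

Definition translate h J : hyperplane := (J.1, [set y | J.2 (h^-1 * y)]).

Lemma translateK h : cancel (translate h) (translate h^-1).
Proof.
move=> [v A]; rewrite /translate /=; congr pair.
by apply/seteqP; split=> y /=; rewrite mulVKg.
Qed.

Lemma translateM h g J : translate h (translate g J) = translate (h * g) J.
Proof.
rewrite /translate /=; congr pair.
by apply/seteqP; split=> y /=; rewrite invgM mulgA.
Qed.

Lemma translate1 J : translate 1 J = J.
Proof.
case: J => v A; rewrite /translate /=; congr pair.
by apply/seteqP; split=> y /=; rewrite invg1 mul1g.
Qed.

Lemma translate_dual h x a : translate h (dual x a) = dual (h * x) a.
Proof.
rewrite /translate /dual /=; congr pair.
apply/seteqP; split=> y; rewrite /coset /edge_base /=;
  by case: a.2; rewrite !invgM !mulgA.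
Qed.

Lemma sep_translate h J x y : sep (translate h J) (h * x) (h * y) = sep J x y.
Proof.
have [w ->] := mul_el x y; rewrite mulgA !sep_el /parity; congr (odd _).
have -> : crossings (h * x) w = map (translate h) (crossings x w).
  by elim: w x => //= a w IH x; rewrite -IH translate_dual mulgA.
by rewrite count_map; apply: eq_count => K /=; rewrite (can_eq (translateK h)).
Qed.

(** ** Geodesics and hyperplanes *)

Lemma sep_parab S J x g : parab S g -> ~~ S J.1 -> sep J x (x * g) = false.
Proof.
move=> /parab_word [w <- Sw] nSJ; rewrite sep_el /parity.
rewrite (_ : count_mem J _ = 0%N) //; apply/count_memPn.
apply: contra nSJ => /crossings_label /mapP [a /(allP Sw) Sa ->] //.
Qed.

Lemma sep_coset S J x y : coset S x y -> ~~ S J.1 -> sep J x y = false.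
Proof. by rewrite /coset /= => h nS; rewrite -(mulVKg x y) (sep_parab _ h). Qed.

Lemma first_crossing J x w : J \in crossings x w ->
  exists m b t, [/\ w = m ++ b :: t, J \notin crossings x m & J = dual (x * el m) b].
Proof.
elim: w x => //= a w IH x; rewrite inE; have [-> _|neq /= /IH] := eqVneq J (dual x a).
  by exists [::], a, w; split=> //; rewrite mulg1.
move=> [m [b [t [-> Jm JE]]]]; exists (a :: m), b, t; split=> //.
  by rewrite /= inE negb_or neq.
by rewrite (el_cons _ a m) mulgA.
Qed.

(** Between two consecutive crossings of the same hyperplane a path moves
    parallel to it, so the two crossing letters cancel. *)
Lemma recross x a m b :
    dual x a = dual (x * el (a :: m)) b ->
    dual x a \notin crossings (x * el [:: a]) m ->
  [/\ b = (a.1, ~~ a.2), parab (e a.1) (el m : raag e) &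
      @el V e (a :: m ++ [:: b]) = el m].
Proof.
set J := dual x a => JE Jm.
have sepm : sep J (x * el [:: a]) (x * el (a :: m)) = false.
  rewrite (el_cons _ a m) mulgA sep_el /parity.
  by rewrite (_ : count_mem J _ = 0%N) //; apply/count_memPn.
have sepa : sep J x (x * el [:: a]) by rewrite sep_edge.
have sepb : sep J (x * el (a :: m)) (x * el (a :: m) * el [:: b]).
  by rewrite sep_edge JE.
case/dualP: (JE) => ab cab.
have sepc : sep J (edge_base x a) (edge_base (x * el (a :: m)) b) = false.
  by apply: sep_coset cab _; rewrite adj_irr.
rewrite {}/J in JE Jm sepm sepa sepb sepc *.
case: a b JE Jm sepm sepa sepb sepc ab cab => [v c] [v' c'] /=.
move=> JE Jm sepm sepa sepb sepc ab.
subst v'; rewrite /coset /edge_base /= in sepc *.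
suff key : c' = ~~ c -> parab (e v) (el m : raag e) ->
    [/\ (v, c') = (v, ~~ c), parab (e v) (el m : raag e) &
      @el V e ((v, c) :: m ++ [:: (v, c')]) = el m].
  case: c c' JE Jm sepm sepa sepb sepc key => [] [] /= JE Jm sepm sepa sepb sepc key cab.
  - move: sepc; rewrite (sep_trans (x * el ((v, true) :: m))) sepm.
    by rewrite sepb.
  - apply: key => //; move: cab; rewrite (el_cons _ _ m) [x * (_ * _)]mulgA.
    by rewrite mulKg.
  - apply: key => //; move: cab; rewrite /coset /edge_base /=.
    rewrite (el_cons _ _ m) -!mulgA mulKg !mulgA => cab.
    suff -> : el m = el [:: (v, false)] * el m * el [:: (v, true)] :> raag e by [].
    set l : raag e := el [:: (v, false)]; set g := (X in parab _ X) in cab *.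
    have : commute l g.
      apply: (commute_parab (S := pred1 v) (T := e v)) => //; last exact: parab_letter (eqxx v).
      by move=> u1 u2 /eqP ->.
    rewrite /g -(el_letterV _ v false) -/l => h.
    by apply: (mulgI l); rewrite h mulgVK.
  - move: sepc; rewrite (sep_trans (x * el [:: (v, false)])) sepm.
    by rewrite sepa.
move=> -> pm; split=> //; rewrite el_cons el_cat -(el_letterV _ v c).
have := @commute_parab _ e (pred1 v) (e v) (el [:: (v, c)]) (el m).
rewrite /commute mulgA => -> //; first by rewrite mulgK.
- by move=> u1 u2 /eqP ->.
- exact: parab_letter (eqxx v).
Qed.

Lemma not_uniq_shorten x w : ~~ uniq (crossings x w) -> (len (el w : raag e) < size w)%N.
Proof.
elim: w x => //= a w IH x; rewrite negb_and negbK => /orP[|/IH]; last first.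
  rewrite el_cons; move: (lenM (el [:: a]) (el w : raag e)) (len_letter e a); lia.
move=> /first_crossing [m [b [t [-> Jm JE]]]].
rewrite -mulgA -el_cons in JE.
have [_ _ elE] := recross JE Jm.
have -> : a :: m ++ b :: t = (a :: m ++ [:: b]) ++ t by rewrite /= -catA.
rewrite el_cat elE -el_cat.
by rewrite (leq_ltn_trans (len_el _ _)) // !size_cat /=; lia.
Qed.

Lemma geodesic_uniq x w : len (el w : raag e) = size w -> uniq (crossings x w).
Proof. by move=> lw; apply/negPn/negP => /not_uniq_shorten; rewrite lw ltnn. Qed.

(** The hyperplanes that separate [x] from [y], read along a geodesic. *)
Definition hyps x y := crossings x (projT1 (cid2 (geodesic_word (x^-1 * y)))).

Lemma hypsP x y : exists w, [/\ hyps x y = crossings x w, y = x * el w &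
  len (el w : raag e) = size w].
Proof.
rewrite /hyps; case: cid2 => w wE lw /=; exists w; split=> //.
  by rewrite wE mulVKg.
by rewrite wE lw.
Qed.

Lemma hyps_uniq x y : uniq (hyps x y).
Proof. by have [w [-> _ lw]] := hypsP x y; apply: geodesic_uniq. Qed.

Lemma size_hyps x y : size (hyps x y) = dist x y.
Proof. by have [w [-> -> lw]] := hypsP x y; rewrite size_crossings /dist mulKg. Qed.

Lemma mem_hyps x y J : (J \in hyps x y) = sep J x y.
Proof.
have := hyps_uniq x y; have [w [-> -> lw]] := hypsP x y => u.
by rewrite sep_el /parity count_uniq_mem // oddb.
Qed.

Lemma uniq_geodesic x w : uniq (crossings x w) -> len (el w : raag e) = size w.
Proof.
move=> u; apply/eqP; rewrite eqn_leq len_el /=.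
rewrite -[X in (_ <= len X)%N](mulKg x) -/(dist _ _) -size_hyps -(size_crossings x w).
apply: uniq_leq_size => // J Jw.
by rewrite mem_hyps sep_el /parity count_uniq_mem // Jw.
Qed.

(** A hyperplane that does not have [x], [y] and [z] on one side separates exactly
    two of the three pairs. *)
Lemma gromov_count z x y :
  exists2 s : seq hyperplane, uniq s /\ (forall J, (J \in s) = sep J z x && sep J z y) &
    (dist z x + dist z y = dist x y + (size s).*2)%N.
Proof.
exists [seq J <- hyps z x | sep J z y].
  by split=> [|J]; rewrite ?filter_uniq ?hyps_uniq // mem_filter mem_hyps andbC.
have perm1 : perm_eq [seq J <- hyps z x | sep J z y] [seq J <- hyps z y | sep J z x].
  apply: uniq_perm; rewrite ?filter_uniq ?hyps_uniq // => J.
  by rewrite !mem_filter !mem_hyps andbC.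
have perm2 : perm_eq (hyps x y) ([seq J <- hyps z x | ~~ sep J z y] ++
                                 [seq J <- hyps z y | ~~ sep J z x]).
  apply: uniq_perm; rewrite ?hyps_uniq //.
    rewrite cat_uniq !filter_uniq ?hyps_uniq ?andbT //=; apply/hasPn => J.
    by rewrite !mem_filter !mem_hyps => /andP[/negbTE -> _]; rewrite andbF.
  move=> J; rewrite mem_cat !mem_filter !mem_hyps (sep_trans z J x y) (sepC J x z).
  by do 2!case: sep.
have c p q : (count (fun J => sep J z q) (hyps z p) +
    count (fun J => ~~ sep J z q) (hyps z p) = dist z p)%N.
  by rewrite -size_hyps -(count_predC (fun J => sep J z q)).
have := perm_size perm1; have := perm_size perm2; have := c x y; have := c y x.
rewrite size_cat !size_filter size_hyps -addnn.
do 4![move: (count _ _) => ?]; move: (dist z x) (dist z y) (dist x y) => *.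
lia.
Qed.

Lemma gromov_bound z x y p : 
  (forall J, sep J z x -> sep J z y -> sep J z p) ->
  (dist z x + dist z y <= dist x y + (dist z p).*2)%N.
Proof.
move=> h; have [s [us sE] ->] := gromov_count z x y.
rewrite leq_add2l leq_double -size_hyps; apply: uniq_leq_size => // J.
by rewrite sE mem_hyps => /andP[]; exact: h.
Qed.

(** ** Crossing hyperplanes *)

(** For [J] and [K] that do separate points, this says that all four quadrants
    are nonempty: [x] yields the quadrant on its side of [J] and on the other
    side of [K]. *)
Definition cross J K := forall x, exists2 y, ~~ sep J x y & sep K x y.

Lemma crossP J K p1 p2 p3 p4 :
  sep K p1 p2 -> ~~ sep J p1 p2 -> sep J p1 p3 -> sep K p3 p4 -> ~~ sep J p3 p4 ->
  cross J K.
Proof.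
move=> K12 J12 J13 K34 J34 x.
have [J1|/negbTE J1] := boolP (sep J x p1); last first.
  have [K1|/negbTE K1] := boolP (sep K x p1); first by exists p1; rewrite ?J1.
  exists p2; first by rewrite (sep_trans p1) J1.
  by rewrite (sep_trans p1) K1.
have J3 : sep J x p3 = false by rewrite (sep_trans p1) J1 J13.
have [K1|/negbTE K1] := boolP (sep K x p3); first by exists p3; rewrite ?J3.
exists p4; first by rewrite (sep_trans p3) J3.
by rewrite (sep_trans p3) K1.
Qed.

(** Moving parallel to an edge that is not dual to [J] and whose label is not
    adjacent to that of [J], one never meets [J]. *)
Lemma carrier_sep J x a y b : dual x a = dual y b -> J <> dual x a -> ~~ e a.1 J.1 ->
  sep J x y = false.
Proof.
move=> ab nJ neJ.
have base z c : dual x a = dual z c -> sep J z (edge_base z c) = false.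
  move=> xz; rewrite /edge_base; case: c.2; last exact: sep_xx.
  by rewrite sep_edge; apply/eqP => JE; apply: nJ; rewrite xz.
rewrite (sep_trans (edge_base x a)) base // addFb (sep_trans (edge_base y b)).
rewrite (sepC J _ y) base // addbF.
by case/dualP: ab => _ /sep_coset; apply.
Qed.

Lemma sep_crossed K x w : sep K x (x * el w) ->
  exists m b t, w = m ++ b :: t /\ K = dual (x * el m) b.
Proof.
rewrite sep_el /parity => h; have : K \in crossings x w.
  by apply/negPn/negP => /count_memPn hc; rewrite hc in h.
by move=> /first_crossing [m [b [t [-> _ ->]]]]; exists m, b, t.
Qed.

(** The carrier of [K] lies on one side of [J]. A geodesic between points on the
    other side that are separated by [K] would visit this carrier, hence cross
    [J] twice. *)
Lemma not_cross x a K : dual x a <> K -> ~~ e a.1 K.1 -> ~ cross (dual x a) K.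
Proof.
set J := dual x a => JK neJK Jcr.
have [y _ Ky] := Jcr 1; have [z [c KE]] := sep_real Ky.
have [z0 Jz0] : exists z0, sep J z z0.
  have [?|nJ] := boolP (sep J z x); first by exists x.
  by exists (x * el [:: a]); rewrite (sep_trans x) (negbTE nJ) sep_edge /J eqxx.
have [z1 Jz1 Kz1] := Jcr z0.
have [w [_ zE lw]] := hypsP z0 z1; rewrite {z1}zE in Jz1 Kz1.
have [m [b [t [wE KE']]]] := sep_crossed Kz1.
have Jzm : sep J z (z0 * el m) = false.
  apply: (@carrier_sep J z c _ b); rewrite -?KE //.
  by move: neJK; rewrite KE /= adj_sym.
have Jm : sep J z0 (z0 * el m) by rewrite (sep_trans z) sepC Jz0 Jzm.
have Jt : sep J (z0 * el m) (z0 * el m * el (b :: t)).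
  rewrite -mulgA -el_cat -wE (sep_trans z0) sepC Jm.
  by rewrite (negbTE Jz1).
have := geodesic_uniq z0 lw; rewrite wE crossings_cat cat_uniq => /and3P[_ /hasPn/(_ J) + _].
have mem y' s : sep J y' (y' * el s) -> J \in crossings y' s.
  by rewrite sep_el /parity => h; apply/negPn/negP => /count_memPn hc; rewrite hc in h.
by rewrite !mem // => /(_ isT).
Qed.

End Hyperplanes.

Arguments hyperplane {V} e.
Arguments dual {V e} x%_group_scope a.
Arguments sep {V e} J (x y)%_group_scope.
Arguments translate {V e} h%_group_scope J.
Arguments cross {V e} J K.
Arguments crossings {V e} x%_group_scope w.

(** * Integer powers *)

Section IntegerPowers.
Variable G : groupType.
Implicit Types (g h : G) (m n : int).

Lemma zpow_nat g (n : nat) : zpow g (Posz n) = g ^+ n.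
Proof. by []. Qed.

Lemma zpow_neg g (n : nat) : zpow g (- Posz n)%R = g ^- n.
Proof. by case: n => [|n]; rewrite ?expg0 ?invg1. Qed.

Lemma zpowS g n : zpow g (n + 1)%R = zpow g n * g.
Proof.
case: n => n; first by rewrite -PoszD addn1 !zpow_nat expgSr.
rewrite NegzE (_ : (- Posz n.+1 + 1 = - Posz n)%R); last lia.
by rewrite !zpow_neg expgS invgM mulgVK.
Qed.

Lemma zpowB1 g n : zpow g (n - 1)%R = zpow g n * g^-1.
Proof. by rewrite -[in RHS](GRing.subrK 1%R n) zpowS mulgK. Qed.

Lemma zpowD g m n : zpow g (m + n)%R = zpow g m * zpow g n.
Proof.
elim/int_rect: n => [|n IH|n IH]; first by rewrite GRing.addr0 /= mulg1.
  by rewrite -addn1 PoszD GRing.addrA !zpowS IH mulgA.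
rewrite (_ : (- Posz n.+1 = - Posz n - 1)%R); last lia.
by rewrite GRing.addrA !zpowB1 IH mulgA.
Qed.

Lemma zpowN g n : zpow g (- n)%R = (zpow g n)^-1.
Proof. by apply: (mulgI (zpow g n)); rewrite -zpowD GRing.subrr mulgV. Qed.

Lemma zpowV g n : zpow g^-1 n = (zpow g n)^-1.
Proof. by case: n => n /=; rewrite expVgn. Qed.

Lemma zpow_conj g h n : zpow (h * g * h^-1) n = h * zpow g n * h^-1.
Proof.
have X (k : nat) : (h * g * h^-1) ^+ k = h * g ^+ k * h^-1.
  elim: k => [|k IH]; first by rewrite !expg0 mulg1 mulgV.
  by rewrite !expgS IH !mulgA mulgVK.
by case: n => n /=; rewrite X // !invgM invgK mulgA.
Qed.

End IntegerPowers.

(** * Axes of conjugation-minimal elements *)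

Section Axis.
Variables (V : finType) (e : simple_graph V).
Implicit Types (g h x y z p : raag e) (S T : pred V) (J K : hyperplane e).

Definition conj_minimal g := forall k, (len g <= len (k^-1 * g * k))%N.

Lemma conj_minimalP g : exists k c, conj_minimal c /\ g = k * c * k^-1.
Proof.
have ex : exists n, `[< exists k, len (k^-1 * g * k) = n >].
  by exists (len (1^-1 * g * 1)); apply/asboolP; exists 1.
case: (ex_minnP ex) => n /asboolP[k kn] nmin.
exists k, (k^-1 * g * k); split; last by rewrite !mulgA mulgV mul1g mulgK.
move=> k'; rewrite kn; apply: nmin; apply/asboolP; exists (k * k').
by rewrite invgM !mulgA.
Qed.

Section Periodic.
Variables (a0 : V * bool) (w : word V).
Hypothesis w_min : conj_minimal (el w : raag e).
Hypothesis w_geo : len (el w : raag e) = size w.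
Hypothesis w_pos : (0 < size w)%N.

Let l := size w.
Let c : raag e := el w.

Definition per_letter i := nth a0 w (i %% size w).
(** The subword of length n at position i of the infinite word w w w and so on. *)
Definition window i n : word V := mkseq (fun k => per_letter (i + k)) n.
Arguments window : simpl never.

Lemma size_window i n : size (window i n) = n.
Proof. exact: size_mkseq. Qed.

Lemma windowS i n : window i n.+1 = per_letter i :: window i.+1 n.
Proof.
rewrite /window /mkseq /= addn0; congr cons.
rewrite (iotaDl 1) -map_comp; apply: eq_map => k /=.
by rewrite addnA addn1.
Qed.

Lemma window_cat i m n : window i (m + n) = window i m ++ window (i + m) n.
Proof.
elim: m i => [|m IH] i; first by rewrite add0n addn0.
by rewrite addSn !windowS IH /= addSnnS.
Qed.

Lemma per_letter_period k i : per_letter (k * l + i) = per_letter i.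
Proof. by rewrite /per_letter modnMDl. Qed.

Lemma window_period k i n : window (k * l + i) n = window i n.
Proof. by apply: eq_mkseq => j; rewrite -addnA per_letter_period. Qed.

Lemma window_full : window 0 l = w.
Proof.
apply: (@eq_from_nth _ a0); rewrite size_window // => i il.
by rewrite nth_mkseq // /per_letter add0n modn_small.
Qed.

(** The vertices along the infinite path that reads [w] periodically. *)
Definition ax i : raag e := el (window 0 i).

Lemma ax0 : ax 0 = 1.
Proof. by []. Qed.

Lemma axD i n : ax (i + n) = ax i * el (window i n).
Proof. by rewrite /ax window_cat el_cat. Qed.

Lemma axS i : ax i.+1 = ax i * el [:: per_letter i].
Proof. by rewrite -addn1 axD windowS. Qed.

Lemma ax_shift i : ax (l + i) = c * ax i.
Proof. by rewrite axD -[l]mul1n -[(1 * l)%N]addn0 window_period addn0 mul1n {1}/ax window_full. Qed.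

Lemma ax_period k i : ax (k * l + i) = c ^+ k * ax i.
Proof.
elim: k => [|k IH]; first by rewrite mul1g.
by rewrite mulSn -addnA ax_shift IH expgS mulgA.
Qed.

Lemma window_geodesic i : len (el (window i l) : raag e) = l.
Proof.
apply/eqP; rewrite eqn_leq -{2}(size_window i l) len_el /=.
rewrite -[X in (X <= _)%N]w_geo -[el (window i l)](mulKg (ax i)) -axD addnC ax_shift.
by rewrite mulgA; exact: w_min.
Qed.

(** The letters of a shortest coincidence of dual hyperplanes cancel around a
    word in the link of their label. Inside one period this contradicts the
    minimality of the conjugacy representative; over more than one period the
    label itself occurs in between, although it is not in its own link. *)
Lemma window_uniq x i n : uniq (crossings x (window i n)).
Proof.
elim/ltn_ind: n i x => -[|[|n]] IH i x //.
have IH1 := IH n.+1 (ltnSn _) i x.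
have IH2 := IH n.+1 (ltnSn _) i.+1 (x * el [:: per_letter i]).
rewrite windowS crossings_cons cons_uniq IH2 andbT.
rewrite windowS crossings_cons cons_uniq in IH1.
case/andP: IH1 => nin u.
rewrite -[n.+1]addn1 window_cat crossings_cat mem_cat negb_or nin andTb.
rewrite [window (_ + _) 1]windowS crossings_cons inE.
apply/negP => /eqP; rewrite -mulgA -el_cons => dE.
have [bE pm _] := recross dE nin.
have gm := uniq_geodesic u; have /allP link := parab_geodesic pm gm.
(* Within one period: compare with a geodesic window of length [l]. *)
have [nl|ln] := leqP n.+2 l.
  have := geodesic_uniq x (etrans (window_geodesic i) (esym (size_window i l))).
  rewrite -(subnKC nl) window_cat crossings_cat cat_uniq => /and3P[+ _ _].
  rewrite windowS crossings_cons cons_uniq -[n.+1]addn1 window_cat crossings_cat.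
  rewrite mem_cat negb_or => /andP[/andP[_ +] _].
  rewrite [window (_ + _) 1]windowS crossings_cons inE => /eqP; apply.
  by rewrite dE (el_cons _ (per_letter i)) mulgA.
have iE : per_letter (l + i) = per_letter i by rewrite -{1}[l]mul1n per_letter_period.
(* Exactly one period apart, the letters are equal instead of inverse. *)
move: ln; rewrite ltnS leq_eqVlt => /orP[/eqP lE|ln].
  move: bE; rewrite (_ : i.+1 + n = l + i)%N ?iE; last lia.
  by case: (per_letter i) => v [].
have /link : per_letter i \in window i.+1 n.
  apply/mapP; exists (l.-1)%N; first by rewrite mem_iota; lia.
  by rewrite -iE; congr per_letter; lia.
by rewrite adj_irr.
Qed.

Definition axis_hyp i : hyperplane e := dual (ax i) (per_letter i).

Lemma axis_hyp_label i : (axis_hyp i).1 = (per_letter i).1.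
Proof. by []. Qed.

Lemma crossings_axis i n : crossings (ax i) (window i n) = map axis_hyp (iota i n).
Proof.
elim: n i => [|n IH] i //; rewrite windowS crossings_cons; congr cons.
by rewrite -axS IH.
Qed.

Lemma axis_hyp_inj : injective axis_hyp.
Proof.
move=> i j ij; have := window_uniq (ax 0) 0 (maxn i j).+1.
rewrite crossings_axis => u; apply/eqP.
have sz : size (map axis_hyp (iota 0 (maxn i j).+1)) = (maxn i j).+1.
  by rewrite size_map size_iota.
rewrite -(nth_uniq (axis_hyp 0) _ _ u) ?sz ?ltnS ?leq_maxl ?leq_maxr //.
by rewrite !(nth_map 0%N) ?size_iota ?nth_iota ?ltnS ?leq_maxl ?leq_maxr // ij.
Qed.

Lemma sep_axis_hyp i m n : (m <= n)%N -> sep (axis_hyp i) (ax m) (ax n) = (m <= i < n)%N.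
Proof.
move=> mn; rewrite -(subnKC mn) axD sep_el /parity crossings_axis.
have u : uniq (map axis_hyp (iota m (n - m))).
  by rewrite map_inj_uniq ?iota_uniq //; exact: axis_hyp_inj.
by rewrite count_uniq_mem // oddb (mem_map axis_hyp_inj) mem_iota.
Qed.

Lemma translate_axis k i : translate (c ^+ k) (axis_hyp i) = axis_hyp (k * l + i).
Proof. by rewrite /axis_hyp translate_dual ax_period per_letter_period. Qed.

Lemma sep_axis_int m n : (m <= n)%R ->
  sep (axis_hyp 0) (zpow c m) (zpow c n) = (m <= 0 < n)%R.
Proof.
have pw (k : nat) : c ^+ k = ax (k * l).
  by rewrite -[(k * l)%N]addn0 ax_period ax0 mulg1.
case: m => m mn.
  case: n mn => n mn; last lia.
  rewrite !zpow_nat !pw sep_axis_hyp; nia.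
have [k nE] : exists k : nat, n = (Posz k - Posz m.+1)%R.
  exists `|(n + Posz m.+1)%R|%N; lia.
rewrite -(sep_translate (c ^+ m.+1)) nE -zpow_nat -!zpowD translate_axis.
rewrite (_ : (Posz m.+1 + Negz m = 0)%R); last lia.
rewrite (_ : (Posz m.+1 + (Posz k - Posz m.+1) = Posz k)%R); last lia.
rewrite (_ : zpow c 0 = ax 0) // zpow_nat pw sep_axis_hyp // addn0 /= ltn_pmul2r //.
lia.
Qed.

(** [nested i j]: the half-space behind the i-th hyperplane of the axis lies
    behind the j-th one. *)
Definition nested i j := forall x, sep (axis_hyp j) 1 x -> sep (axis_hyp i) 1 x.

Lemma nested_trans j i k : nested i j -> nested j k -> nested i k.
Proof. by move=> ij jk x /jk /ij. Qed.

(** Otherwise the two hyperplanes would cross, by the four points [1], [x] and the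
    far ends of the two edges of the axis. *)
Lemma nested_lt i j : (i < j)%N -> ~~ e (per_letter i).1 (per_letter j).1 -> nested i j.
Proof.
move=> ij nadj x Jx; apply/negPn/negP => nJx.
have neq : axis_hyp i <> axis_hyp j by move=> /axis_hyp_inj ijE; rewrite ijE ltnn in ij.
apply: (not_cross neq); first by rewrite axis_hyp_label.
apply: (@crossP _ _ _ _ (ax 0) x (ax i.+1) (ax j.+1)) => //.
all: by rewrite sep_axis_hyp //; lia.
Qed.

Lemma cross_nested K i r j : nested i r -> nested r j ->
  cross (axis_hyp i) K -> cross (axis_hyp j) K -> cross (axis_hyp r) K.
Proof.
move=> ir rj /(_ 1) [y niy Ky] /(_ (ax j.+1)) [y' njy' Ky'].
have J1 : sep (axis_hyp j) 1 (ax j.+1) by rewrite -ax0 sep_axis_hyp //; lia.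
have Jy' : sep (axis_hyp j) 1 y' by rewrite (sep_trans (ax j.+1)) J1 (negbTE njy').
apply: (@crossP _ _ _ _ 1 y (ax j.+1) y') => //; last 2 first.
- exact: rj.
- by rewrite (sep_trans 1) (sepC _ _ 1) (rj _ J1) (rj _ Jy').
by apply: contra niy => /ir.
Qed.

Lemma cross_axis_label K r : cross (axis_hyp r) K -> e (per_letter r).1 K.1.
Proof.
move=> cr; apply/negPn/negP => nadj; apply: (not_cross _ _ cr) => //.
by move=> rK; have [y /negbTE + /[dup]] := cr 1; rewrite -rK => ->.
Qed.

Definition letters : pred V := fun v => v \in [seq a.1 | a <- w].

Definition anti_adj : rel V := fun u v => [&& letters u, letters v & ~~ e u v].

Definition first_vertex := (per_letter 0).1.

(** The vertices joined to the first letter by a path of the complement graph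
    inside the support. *)
Definition anti_component : pred V := connect anti_adj first_vertex.

Lemma anti_adj_sym : connect_sym anti_adj.
Proof.
by apply: sym_connect_sym => u v; rewrite /anti_adj adj_sym andbCA.
Qed.

Lemma next_occurrence r v : letters v -> exists2 s, (r < s)%N & (per_letter s).1 = v.
Proof.
case/mapP => a /(nthP a0) [i il <-] ->; exists (r.+1 * l + i)%N; first nia.
by rewrite per_letter_period /per_letter modn_small.
Qed.

Lemma first_letter : letters first_vertex.
Proof.
by apply/mapP; exists (per_letter 0) => //; rewrite /per_letter mod0n mem_nth.
Qed.

(** Consecutive labels on a path of the complement graph are not adjacent, so
    successive occurrences of them along the axis have nested hyperplanes. *)
Lemma anti_path r v : connect anti_adj (per_letter r).1 v ->
  exists s, [/\ (r <= s)%N, nested r s & (per_letter s).1 = v].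
Proof.
case/connectP => p; elim: p r => [|u p IH] r /= => [_ ->|/andP[ru up] vE].
  by exists r; split.
case/and3P: (ru) => _ /(next_occurrence r) [s rs sE] neru.
have [] := IH s; rewrite ?sE // => t [st nst tE].
exists t; split=> //; first lia.
by apply: nested_trans nst; apply: nested_lt; rewrite ?sE.
Qed.

Lemma nested_multiple k k' : (k <= k')%N -> nested (k * l) (k' * l).
Proof.
rewrite leq_eqVlt => /orP[/eqP -> //|kk']; apply: nested_lt; first by rewrite ltn_pmul2r.
by rewrite -[(k * l)%N]addn0 -[(k' * l)%N]addn0 !per_letter_period adj_irr.
Qed.

Lemma anti_chain v : anti_component v -> exists k, forall k', (k <= k')%N ->
  exists2 r, (per_letter r).1 = v & nested 0 r /\ nested r (k' * l).
Proof.
move=> vC; have [r [_ nr rE]] := anti_path vC.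
have := vC; rewrite /anti_component anti_adj_sym -rE => /anti_path [s [_ ns sE]].
exists s.+1 => k' sk; exists r => //; split=> //.
apply: nested_trans ns _; apply: nested_trans (nested_multiple sk).
apply: nested_lt; first nia.
by rewrite -[(s.+1 * l)%N]addn0 per_letter_period sE adj_irr.
Qed.

(** A hyperplane crossing both would also cross a nested chain between them that
    carries all labels of the component, and its own label would be adjacent to
    all of these. *)
Lemma strongly_separated : (forall u, exists2 v, anti_component v & ~~ e v u) ->
  exists2 N, (0 < N)%N & forall K, cross (axis_hyp 0) K ->
    ~ cross (translate (c ^+ N) (axis_hyp 0)) K.
Proof.
move=> nou; have ex v : exists k, anti_component v -> forall k', (k <= k')%N ->
    exists2 r, (per_letter r).1 = v & nested 0 r /\ nested r (k' * l).
  have [vC|] := boolP (anti_component v); last by exists 0%N.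
  by have [k kP] := anti_chain vC; exists k.
have [f fP] := choice ex.
exists (\max_v f v).+1 => // K K0 KN.
have [v vC nadj] := nou K.1.
have [|r rE [nr rn]] := fP v vC (\max_v f v).+1.
  by rewrite ltnW // ltnS (leq_bigmax v).
rewrite translate_axis addn0 in KN.
have := cross_axis_label (cross_nested nr rn K0 KN).
by rewrite rE (negbTE nadj).
Qed.

Lemma len_power n : len (c ^+ n) = (n * l)%N.
Proof.
have -> : c ^+ n = el (window 0 (n * l)).
  by rewrite -/(ax _) -[(n * l)%N]addn0 ax_period mulg1.
by rewrite (uniq_geodesic (window_uniq 1 0 _)) size_window.
Qed.

Lemma split_word T (s : word V) : (forall a b, a \in s -> b \in s ->
    T a.1 -> ~~ T b.1 -> e a.1 b.1) ->
  @el V e s = el (ret_word T s) * el (ret_word (predC T) s).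
Proof.
elim: s => [|a s IH] h; first by rewrite mulg1.
rewrite el_cons IH /=; last by move=> x y xs ys; apply: h; rewrite inE ?xs ?ys orbT.
case: ifP => Ta /=; first by rewrite (el_cons _ a (ret_word T s)) mulgA.
rewrite (el_cons _ a (ret_word (predC T) s)) !mulgA; congr (_ * _).
apply/commute_sym.
apply: (commute_parab (S := [pred v | T v & v \in [seq a.1 | a <- s]]) (T := pred1 a.1)).
- move=> u v /= /andP[Tu /mapP [b bs ub]] /eqP ->; rewrite ub; apply: h; rewrite ?inE ?eqxx //.
  + by rewrite bs orbT.
  + by rewrite -ub.
  + by rewrite Ta.
- apply: parab_el; apply/allP => b; rewrite mem_filter => /andP[/= -> bs].
  by apply/mapP; exists b.
- by apply: parab_letter; exact: eqxx.
Qed.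

(** Letters of the support outside the component are adjacent to all of it. *)
Lemma component_split u : (forall v, anti_component v -> e v u) ->
  exists S1 S2 c1 c2, [/\ forall v v', S1 v -> S2 v' -> e v v',
    forall v, S1 v -> e v u, parab S1 c1 /\ parab S2 c2, c = c1 * c2 & c1 <> 1].
Proof.
move=> uP; pose T := anti_component.
have wE : c = el (ret_word T w) * el (ret_word (predC T) w).
  apply: split_word => a b aw bw Ta nTb; apply/negPn/negP => nab.
  move/negP: nTb; apply; apply: connect_trans Ta _; apply: connect1.
  by rewrite /anti_adj nab /letters !map_f.
exists T, [pred v | letters v & ~~ T v], (el (ret_word T w)), (el (ret_word (predC T) w)).
split=> //.
- move=> v v' Tv /= /andP[lv' nTv']; apply/negPn/negP => nvv'.
  move/negP: nTv'; apply; apply: (connect_trans Tv); apply: connect1.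
  rewrite /anti_adj lv' nvv' !andbT.
  case/connectP: Tv => p; case/lastP: p => [_ ->|p v1]; first exact: first_letter.
  by rewrite rcons_path last_rcons => /andP[_ /and3P[_ + _]] ->.
- split; apply: parab_el; apply/allP => a; rewrite mem_filter => /andP[] //=.
  by move=> -> aw; rewrite /letters map_f.
- move=> h; have := len_el e (ret_word (predC T) w).
  rewrite h mul1g in wE; rewrite -wE w_geo size_filter.
  have <- := count_predC (fun a : V * bool => T a.1) w.
  rewrite -[X in (_ <= X)%N]add0n leq_add2r leqn0 => /eqP c0.
  have : (0 < count (fun a : V * bool => T a.1) w)%N; last by rewrite c0.
  rewrite -has_count; apply/hasP; exists (per_letter 0).
    by rewrite /per_letter mod0n mem_nth.
  exact: connect0.
Qed.

End Periodic.

Lemma conj_minimal_word g : conj_minimal g -> g <> 1 ->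
  exists w : word V, [/\ g = el w, conj_minimal (el w), len (el w : raag e) = size w &
     (0 < size w)%N].
Proof.
move=> gm g1; have [w wE lw] := geodesic_word g.
exists w; rewrite wE; split=> //.
by rewrite lt0n; apply/eqP => w0; apply: g1; rewrite -wE (size0nil w0).
Qed.

(** For a conjugation-minimal element the length of powers is linear. The
    constant due to the conjugating element disappears when the exponent is
    multiplied by a large number. *)
Lemma len_power_ge g n : g <> 1 -> (n <= len (g ^+ n))%N.
Proof.
have [k [c [cmin ->]]] := conj_minimalP g => g1.
have c1 : c <> 1 by move=> c1; apply: g1; rewrite c1 mulg1 mulgV.
have X (m : nat) : (k * c * k^-1) ^+ m = k * c ^+ m * k^-1.
  by have := zpow_conj c k (Posz m); rewrite !zpow_nat.
have [w [cE wmin wlen wpos]] := conj_minimal_word cmin c1.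
have cX (m : nat) : len (c ^+ m) = (m * size w)%N.
  case: (w) wmin wlen wpos cE => [|a w'] // wmin wlen wpos ->.
  exact: (len_power a).
(* Compare the lengths of the (m n)-th powers of [c] and of its conjugate. *)
have key m : (m * n <= m * len ((k * c * k^-1) ^+ n) + (len k).*2)%N.
  rewrite X; set x := k * c ^+ n * k^-1.
  have : c ^+ (m * n) = k^-1 * x ^+ m * k.
    rewrite /x; have := zpow_conj (c ^+ n) k (Posz m); rewrite !zpow_nat => ->.
    by rewrite mulnC expgnA !mulgA mulVg mul1g mulgVK.
  move=> cE'; have := cX (m * n)%N; rewrite cE' => lE.
  have := lenM (k^-1 * x ^+ m) k; have := lenM (k^-1) (x ^+ m); have := lenX x m.
  rewrite lenV lE; have := leq_pmulr (m * n) wpos.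
  move: (len k) (m * len x)%N (len (x ^+ m)) (len (_ * _)) (m * n)%N (m * n * _)%N => *; lia.
have := key (len k).*2.+1; move: (len (_ ^+ n)) (len k).*2 => L a h.
rewrite leqNgt; apply/negP => Ln; have := leq_mul (leqnn a.+1) Ln; lia.
Qed.

(** An element [c] with [strong_axis c J N] translates the hyperplane [J] along
    an axis, and no hyperplane crosses both [J] and its N-th translate. *)
Definition strong_axis c J N :=
  [/\ (0 < N)%N,
    forall m n, (m <= n)%R -> sep J (zpow c m) (zpow c n) = (m <= 0 < n)%R &
    forall K, cross J K -> ~ cross (translate (zpow c (Posz N)) J) K].

(** In the first case a component of the complement graph on the support of [c]
    has a common neighbour [u]; the factor [c1] is the part of [c] in that
    component and [c2] is the rest. *)
Lemma minimal_dichotomy c : conj_minimal c -> c <> 1 ->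
  (exists S1 S2 u c1 c2, [/\ forall v v', S1 v -> S2 v' -> e v v',
    forall v, S1 v -> e v u, parab S1 c1 /\ parab S2 c2, c = c1 * c2 & c1 <> 1])
  \/ exists J N, strong_axis c J N.
Proof.
move=> cmin c1; have [w [-> wmin wlen wpos]] := conj_minimal_word cmin c1.
case: (w) wmin wlen wpos => [|a w'] // wmin wlen wpos.
have [[u uP]|nou] := pselect (exists u, forall v, anti_component a (a :: w') v -> e v u).
  left; have [S1 [S2 [d1 [d2 h]]]] := component_split wlen wpos uP.
  by exists S1, S2, u, d1, d2.
right; have [|N N0 NP] := strongly_separated wmin wlen wpos (a0 := a).
  move=> u; have [] := pselect (exists2 v, anti_component a (a :: w') v & ~~ e v u) => // h.
  exfalso; apply: nou; exists u => v vC; apply/negPn/negP => nvu; apply: h.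
  by exists v.
exists (axis_hyp a (a :: w') 0), N; split=> // m n; exact: sep_axis_int.
Qed.

End Axis.

Arguments strong_axis {V e} c%_group_scope J N.
Arguments conj_minimal {V e} g%_group_scope.

(** * Contraction *)

Section Contraction.
Variables (V : finType) (e : simple_graph V).
Implicit Types (g h c p q x y z : raag e) (J K : hyperplane e) (N : nat).

Lemma cross_translate h J K : cross J K -> cross (translate h J) (translate h K).
Proof.
move=> JK x; have [y Jy Ky] := JK (h^-1 * x).
by exists (h * y); rewrite -(mulVKg h x) !sep_translate.
Qed.

(** Reversing the axis exchanges the two directions along it. *)
Lemma strong_axisV c J N : strong_axis c J N -> strong_axis c^-1 (translate c^-1 J) N.
Proof.
move=> [N0 sJ ss]; have shift m : zpow c^-1 m = c^-1 * zpow c (1 - m)%R.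
  by rewrite zpowV -zpowN zpowD mulKg.
split=> // [m n mn|K K1 K2].
  rewrite !shift sep_translate sepC sJ; lia.
have E : c ^+ N.+1 * (zpow c^-1 (Posz N) * c^-1) = 1.
  by rewrite zpowV zpow_nat expgS !mulgA mulgK mulgV.
apply: (ss (translate (c ^+ N.+1) K)).
  by have := cross_translate (c ^+ N.+1) K2; rewrite !translateM -mulgA E translate1.
by have := cross_translate (c ^+ N.+1) K1; rewrite translateM expgSr mulgK.
Qed.

Section StrongAxis.
Variables (c : raag e) (J : hyperplane e) (N : nat).
Hypothesis sa : strong_axis c J N.
Let C (n : int) := zpow c n.
Let Jt (t : int) := translate (C t) J.
Implicit Types (a b i m n r s t : int).

Lemma sep_axis t m n : (m <= n)%R -> sep (Jt t) (C m) (C n) = (m <= t < n)%R.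
Proof.
move=> mn; case: sa => _ sJ _.
have E i : C i = C t * C (i - t)%R.
  by rewrite /C -zpowD; congr zpow; lia.
rewrite (E m) (E n) sep_translate sJ; lia.
Qed.

Lemma not_cross_axis t K : cross (Jt t) K -> ~ cross (Jt (t + Posz N)%R) K.
Proof.
move=> K1 K2; case: sa => _ _ ss.
apply: (ss (translate (C t)^-1 K)).
  by have := cross_translate (C t)^-1 K1; rewrite /Jt translateM mulVg translate1.
by have := cross_translate (C t)^-1 K2; rewrite /Jt translateM /C zpowD mulKg.
Qed.

Lemma sep_nested i s t x : (i <= s)%R -> (s <= t)%R ->
  sep (Jt t) (C i) x -> sep (Jt s) (C i) x.
Proof.
move=> si; rewrite Order.POrderTheory.le_eqVlt => /orP[/eqP -> //|st] tx; apply/negPn/negP => nsx.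
have Jss : sep (Jt s) (C i) (C (s + 1)%R) by rewrite sep_axis; lia.
have neq : Jt s <> Jt t by move=> E; move: Jss; rewrite E sep_axis; lia.
have [z [a JE]] := sep_real Jss.
apply: (@not_cross _ _ z a (Jt t)); rewrite -?JE //.
  have := congr1 fst JE; rewrite /= => <-; by rewrite adj_irr.
apply: (@crossP _ _ _ _ (C i) x (C (s + 1)%R) (C (t + 1)%R)) => //.
all: rewrite sep_axis; lia.
Qed.

Lemma dist_axis m (k : nat) : (dist (C m) (C (m + Posz k)%R) <= k * len c)%N.
Proof. by rewrite /dist /C zpowD mulKg zpow_nat lenX. Qed.

Lemma many_sep s (k : nat) x y :
  (forall r, (s <= r)%R -> (r < s + Posz k)%R -> sep (Jt r) x y) -> (k <= dist x y)%N.
Proof.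
move=> h; rewrite -size_hyps -(size_iota 0 k) -(size_map (fun i : nat => Jt (s + Posz i)%R)).
apply: uniq_leq_size => [|_ /mapP[i + ->]]; last first.
  rewrite mem_iota mem_hyps => ik; apply: h; lia.
rewrite map_inj_in_uniq ?iota_uniq // => i j _ _ E.
have := @sep_axis (s + Posz i)%R (s + Posz i)%R (s + Posz i + 1)%R.
rewrite {1}E; rewrite sep_axis; lia.
Qed.

(** The slack 4 pays for replacing points inside edges by vertices. *)
Definition nearly_nearest q a :=
  forall n, (dist q (C a) <= dist q (C n) + 4)%N.

Let B := (N.+1 * len c)%N.
(** Strong separation leaves at most [B] exceptional hyperplanes, namely some of
    those that separate two orbit points [N + 1] steps apart; they count twice
    in a Gromov product, and the remaining 5 exceeds the slack. *)
Definition gap := (B.*2 + N + 5)%N.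

(** A point whose nearest orbit point is [C a] does not lie beyond a hyperplane
    of the axis far ahead of [C a]: the orbit point just past that hyperplane
    would be nearer, because strong separation leaves few hyperplanes that
    could separate it from both. *)
Lemma nearest_side q a t : nearly_nearest q a -> (a + Posz gap <= t)%R ->
  ~~ sep (Jt t) (C a) q.
Proof.
rewrite /gap => near at_; apply/negP => tq.
set z := C (t + 1)%R; set z1 := C (t - Posz N)%R.
have tN : (a <= t - Posz N)%R by lia.
have J1q := sep_nested tN (_ : (_ <= t)%R) tq.
have [N0 _ _] := sa.
have J1z : sep (Jt (t - Posz N)%R) (C a) z by rewrite sep_axis; lia.
have J2z : sep (Jt t) (C a) z by rewrite sep_axis; lia.
have zz1 : (dist z z1 <= B)%N.
  have -> : z = C (t - Posz N + Posz N.+1)%R by congr C; lia.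
  by rewrite distC dist_axis.
(* Any other [W] would have both its sides meet both sides of the hyperplanes
   with indices [t - N] and [t]. *)
have bound : forall W, sep W z q -> sep W z (C a) -> sep W z z1.
  move=> W Wq Wy; apply/negPn/negP => nW.
  have Wyz1 : sep W (C a) z1 by rewrite (sep_trans z) sepC Wy (negbTE nW).
  apply: (@not_cross_axis (t - Posz N)%R W).
    apply: (@crossP _ _ _ _ (C a) z1 z q) => //.
      by rewrite sep_axis; lia.
    by rewrite (sep_trans (C a)) sepC J1z J1q //; lia.
  rewrite (_ : (t - Posz N + Posz N = t)%R); last lia.
  apply: (@crossP _ _ _ _ (C a) z1 z q) => //.
    by rewrite sep_axis; lia.
  by rewrite (sep_trans (C a)) sepC J2z tq.
have := gromov_bound bound.
have [k kE] : exists k : nat, t = (a + Posz k)%R by exists `|(t - a)%R|%N; lia.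
have zy : (k <= dist z (C a))%N.
  apply: (@many_sep a) => r ar rk; rewrite sepC sep_axis; lia.
have := near (t + 1)%R; rewrite -/z (distC q z).
by move: zz1 zy; move: (dist _ _) (dist _ _) (dist _ _) (dist _ _) => *; lia.
Qed.

(** A point far ahead along the axis is nearer to some orbit point than to any
    point far behind. *)
Lemma bottleneck p q s t : (s + Posz gap <= t)%R ->
    ~~ sep (Jt s) (C s) q -> sep (Jt t) (C t) p ->
  exists n, (dist p (C n) + 4 <= dist p q)%N.
Proof.
rewrite /gap => st nq tp; exists (t - Posz N)%R.
set z := C (t - Posz N)%R; set z4 := C (t + 1)%R.
have [N0 _ _] := sa.
have q_side r : (s <= r)%R -> sep (Jt r) (C s) q = false.
  by move=> sr; apply/negbTE; apply: contra nq; exact: sep_nested.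
have p_side r : (s <= r)%R -> (r <= t)%R -> sep (Jt r) (C s) p.
  move=> sr rt; apply: (@sep_nested s r t) => //.
  rewrite (sep_trans (C t)) tp sep_axis; lia.
have zz4 : (dist z z4 <= B)%N.
  have -> : z4 = C (t - Posz N + Posz N.+1)%R by congr C; lia.
  exact: dist_axis.
(* Again any other [W] would cross the hyperplanes with indices [t - N] and [t]. *)
have bound : forall W, sep W z p -> sep W z q -> sep W z z4.
  move=> W Wp Wq; apply/negPn/negP => nW.
  have W4p : sep W z4 p by rewrite (sep_trans z) sepC Wp (negbTE nW).
  apply: (@not_cross_axis (t - Posz N)%R W).
    apply: (@crossP _ _ _ _ z q z4 p) => //.
    - rewrite (sep_trans (C s)) sepC q_side ?sep_axis; lia.
    - rewrite sep_axis; lia.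
    - rewrite (sep_trans (C s)) sepC p_side ?sep_axis; lia.
  rewrite (_ : (t - Posz N + Posz N = t)%R); last lia.
  apply: (@crossP _ _ _ _ z q z4 p) => //.
  - rewrite (sep_trans (C s)) sepC q_side ?sep_axis; lia.
  - rewrite sep_axis; lia.
  - rewrite (sep_trans (C s)) sepC p_side ?sep_axis; lia.
have := gromov_bound bound.
have [k kE] : exists k : nat, (t - Posz N = s + Posz k)%R.
  exists `|(t - Posz N - s)%R|%N; lia.
have zq : (k <= dist z q)%N.
  apply: (@many_sep s) => r sr rk.
  rewrite (sep_trans (C s)) sepC q_side ?sep_axis; lia.
rewrite (distC p z).
by move: zz4 zq; move: (dist _ _) (dist _ _) (dist _ _) (dist _ _) => *; lia.
Qed.

End StrongAxis.

Arguments gap c%_group_scope N.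
Arguments nearly_nearest (c q)%_group_scope a.

Lemma len_inv_gap c N : gap c^-1 N = gap c N.
Proof. by rewrite /gap lenV. Qed.

(** If the projections of [q] and [q'] are far apart, then many hyperplanes of the
    axis separate [q] from [q']. The point [p] is separated by the middle ones
    either from [q] or from [q'], so an orbit point lies in the ball around [p]
    ([bottleneck], applied in the second case to the reversed axis). *)
Lemma strong_axis_contracting c J N : strong_axis c J N ->
  exists D : nat, forall (p q q' : raag e) (a b : int),
    nearly_nearest c q a -> nearly_nearest c q' b ->
    (D < dist (zpow c a) (zpow c b))%N ->
    exists n, (dist p (zpow c n) + 4 <= dist p q)%N \/
              (dist p (zpow c n) + 4 <= dist p q')%N.
Proof.
move=> sa; pose M := gap c N.
exists ((4 * M + 2) * len c)%N => p q q' a b.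
wlog ab : a b q q' / (a <= b)%R.
  move=> wl na nb Kab; have [ab|/Order.POrderTheory.ltW ba] := Order.TotalTheory.leP a b.
    exact: (wl a b q q').
  have [|n [nq|nq]] := wl b a q' q ba nb na; first by rewrite distC.
    by exists n; right.
  by exists n; left.
move=> na nb; have [k kE] : exists k : nat, b = (a + Posz k)%R.
  by exists `|(b - a)%R|%N; lia.
rewrite kE => /leq_trans/(_ (dist_axis c a k)) lt.
have {lt} kM : (4 * M + 2 < k)%N by move: lt; rewrite ltn_mul2r => /andP[].
pose t := (a + Posz M + Posz M)%R.
have sV := strong_axisV sa.
have zV n : zpow c^-1 n = zpow c (- n)%R by rewrite zpowV zpowN.
have trV r : translate (zpow c^-1 r) (translate c^-1 J) = translate (zpow c (- r - 1)%R) J.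
  by rewrite translateM zV zpowD.
have [tp|ntp] := boolP (sep (translate (zpow c t) J) (zpow c t) p).
  have [||n nq] := @bottleneck c J N sa p q (a + Posz M)%R t _ _ tp.
  - by rewrite /t -/M; lia.
  - have := @nearest_side c J N sa q a (a + Posz M)%R na (Order.POrderTheory.lexx _).
    apply: contra => h.
    by rewrite (sep_trans (zpow c (a + Posz M)%R)) h (sep_axis sa) ?addbT; lia.
  - by exists n; left.
pose u := (t + Posz M)%R.
have nV : nearly_nearest c^-1 q' (- b)%R.
  by move=> n; rewrite !zV GRing.opprK; exact: nb.
have ub : (- b + Posz (gap c^-1 N) <= - u - 1)%R by rewrite len_inv_gap -/M /u /t; lia.
have := nearest_side sV nV ub; rewrite trV zV GRing.opprK.
rewrite (_ : (- (- u - 1) - 1 = u)%R); last lia.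
move=> nuq.
have [|||n nq] := @bottleneck c^-1 _ N sV p q' (- u - 1)%R (- t - 1)%R.
- by rewrite len_inv_gap -/M /u /t; lia.
- rewrite trV zV (_ : (- (- u - 1) - 1 = u)%R); last lia.
  rewrite (_ : (- (- u - 1) = u + 1)%R); last lia.
  apply: contra nuq => h; rewrite (sep_trans (zpow c (u + 1)%R)) h sepC (sep_axis sa) ?addbT.
    by rewrite /u /t; lia.
  by rewrite /u /t; lia.
- rewrite trV zV (_ : (- (- t - 1) - 1 = t)%R); last lia.
  rewrite (_ : (- (- t - 1) = t + 1)%R); last lia.
  rewrite (sep_trans (zpow c t)) sepC (sep_axis sa) ?(negbTE ntp); lia.
by exists (- n)%R; right; rewrite -zV.
Qed.

End Contraction.

Arguments nearly_nearest {V e} c%_group_scope q%_group_scope a.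

(** * Morse subgroups *)

Section Morse.
Variables (V : finType) (e : simple_graph V).
Implicit Types (a b g h x y z : raag e) (H : set (raag e)) (S T : pred V).

Lemma ball_collision K (f : nat -> raag e) : (forall n, (len (f n) <= K)%N) ->
  exists i j, (i < j)%N /\ f i = f j.
Proof.
move=> fK; have ex n : exists b : K.-bseq (V * bool), @el V e b = f n.
  have [w wE lw] := geodesic_word (f n).
  have sw : (size w <= K)%N by rewrite lw.
  by exists (Bseq sw).
have [b bE] := choice ex.
have [inj|] := pselect (injective (fun i : 'I_(#|{: K.-bseq (V * bool)}|.+1) => b i)).
  by have := leq_card _ inj; rewrite card_ord ltnn.
move=> /existsNP [i /existsNP [j /not_implyP [bij ij]]].
have fij : f i = f j by rewrite -!bE bij.
case: (ltngtP i j) => [lt|lt|E]; last by case: ij; apply: val_inj.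
  by exists i, j.
by exists j, i.
Qed.

Lemma finite_ball K : finite_set [set g : raag e | (len g <= K)%N].
Proof.
apply: (@sub_finite_set _ _ ((fun b : K.-bseq (V * bool) => @el V e b) @` setT)); last first.
  exact/finite_image/finite_finset.
move=> g /= gK; have [w wE lw] := geodesic_word g.
have sw : (size w <= K)%N by rewrite lw.
by exists (Bseq sw).
Qed.

(** The Morse property for discrete paths in the word metric. *)
Definition discrete_morse H := forall A : nat, exists K : nat,
  forall (n : nat) (c : nat -> raag e),
  (forall i k, (i + k <= n)%N ->
    (dist (c i) (c (i + k)%N) <= A * k + A)%N /\
    (k <= A * dist (c i) (c (i + k)%N) + A)%N) ->
  H (c 0%N) -> H (c n) ->
  forall i, (i <= n)%N -> exists2 h, H h & (dist (c i) h <= K)%N.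

Definition conjugate_set g H : set (raag e) := [set x | H (g * x * g^-1)].

Lemma subgroupV H x : is_subgroup H -> H x -> H x^-1.
Proof. by case=> H1 HV Hx; rewrite -div1g; apply: HV. Qed.

Lemma subgroupM H x y : is_subgroup H -> H x -> H y -> H (x * y).
Proof. by move=> Hs Hx Hy; rewrite -[y]invgK; apply: Hs.2 => //; exact: subgroupV. Qed.

Lemma subgroupX H x n : is_subgroup H -> H x -> H (x ^+ n).
Proof.
move=> Hs Hx; elim: n => [|n IH]; first exact: Hs.1.
by rewrite expgS; apply: subgroupM.
Qed.

Lemma subgroup_conj g H : is_subgroup H -> is_subgroup (conjugate_set g H).
Proof.
move=> Hs; split; first by rewrite /conjugate_set /= mulg1 mulgV; exact: Hs.1.
move=> x y Hx Hy; rewrite /conjugate_set /=.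
have -> : g * (x / y) * g^-1 = (g * x * g^-1) * (g * y * g^-1)^-1.
  by rewrite !invgM invgK !mulgA mulgVK.
exact: Hs.2.
Qed.

(** Conjugation by [g] changes distances by at most [2 * len g]. *)
Lemma morse_conj g H : discrete_morse H -> discrete_morse (conjugate_set g H).
Proof.
move=> Hm A; pose L := len g; have [K KP] := Hm (A * (2 * L + 1) + 2 * L)%N.
exists (K + 2 * L)%N => n c cq c0 cn i ni.
have tr x y : x^-1 * y = g^-1 * ((g * x * g^-1)^-1 * (g * y * g^-1)) * g.
  by rewrite !invgM invgK !mulgA mulgVK mulgVK mulVg mul1g.
have le1 x y : (dist (g * x * g^-1) (g * y * g^-1) <= dist x y + 2 * L)%N.
  rewrite /dist; have -> : (g * x * g^-1)^-1 * (g * y * g^-1) = g * (x^-1 * y) * g^-1.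
    by rewrite !invgM invgK !mulgA mulgVK.
  have := lenM (g * (x^-1 * y)) g^-1; have := lenM g (x^-1 * y).
  by rewrite lenV -/L; move: (len _) (len _) (len _) => *; lia.
have le2 x y : (dist x y <= dist (g * x * g^-1) (g * y * g^-1) + 2 * L)%N.
  rewrite /dist tr; set t := ((g * x * g^-1)^-1 * _).
  have := lenM (g^-1 * t) g; have := lenM g^-1 t.
  by rewrite lenV -/L; move: (len _) (len _) (len _) => *; lia.
have [|h Hh hK] := KP n (fun i => g * c i * g^-1) _ c0 cn i ni.
  move=> j k jk; have [u l] := cq j k jk.
  have := le1 (c j) (c (j + k)%N); have := le2 (c j) (c (j + k)%N).
  move: (dist _ _) (dist _ _) u l => d1 d2 u l; split; nia.
exists (g^-1 * h * g).
  by rewrite /conjugate_set /= !mulgA mulgV mul1g mulgK.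
apply: leq_trans (le2 _ _) _; rewrite leq_add2r.
by rewrite !mulgA mulgV mul1g mulgK.
Qed.

Lemma flat_difference h u i j m (a : nat) : commute h u ->
  (u ^+ i * h ^+ m)^-1 * (u ^+ j * h ^+ (m + a)) = h ^+ a * (u ^- i * u ^+ j).
Proof.
move=> hu; have cm k : commute (h ^+ k) (u ^- i * u ^+ j).
  by apply: commuteM; [apply: commuteV|]; apply: commuteX2.
have c1 : commute (h ^- m) (u ^- i * u ^+ j) by apply/commute_sym/commuteV/commute_sym.
rewrite invgM expgnDr -!mulgA [u ^- i * (u ^+ j * (_ * _))]mulgA.
by rewrite [h ^- m * (_ * _)]mulgA c1 -mulgA mulKg (cm a).
Qed.

Local Open Scope nat_scope.
(** Coordinates along the path that follows three sides of an n-by-n square: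
    up, across and down again. *)
Definition corner_x n i := if i <= n then i else if i <= 2 * n then n else 3 * n - i.
Definition corner_y n i := if i <= n then 0 else if i <= 2 * n then i - n else n.

Lemma corner_bounds n i k : i + k <= 3 * n ->
  corner_y n i <= corner_y n (i + k) /\
  let s := corner_y n (i + k) - corner_y n i +
    (maxn (corner_x n i) (corner_x n (i + k)) - minn (corner_x n i) (corner_x n (i + k)))
  in s <= 2 * k /\ k <= 3 * s.
Proof.
by rewrite /corner_x /corner_y => ik; do 4?case: ifP => ? //=; split; lia.
Qed.
Local Close Scope nat_scope.

(** Three sides of a rectangle in the flat spanned by [h] and [u] form a
    quasigeodesic of uniform quality between two points of [H]; so its corners
    [u ^+ n] stay close to [H], and two of them differ by an element of [H]. *)
Lemma morse_flat H h u A : is_subgroup H -> discrete_morse H -> H h -> commute h u ->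
  (forall n m, (n + m <= A * len (h ^+ n * u ^+ m))%N /\
               (n + m <= A * len (h ^+ n * u ^- m))%N) ->
  exists2 p, (0 < p)%N & H (u ^+ p).
Proof.
move=> Hs Hm Hh hu flat; pose L := (len h + len u)%N.
have [K KP] := Hm (2 * L + 3 * A)%N.
have near n : exists2 h', H h' & (dist (u ^+ n) h' <= K)%N.
  pose f := corner_x n; pose f' := corner_y n.
  pose c i := u ^+ f i * h ^+ f' i.
  have fn : f n = n by rewrite /f /corner_x leqnn.
  have f'n : f' n = 0%N by rewrite /f' /corner_y leqnn.
  have f0 : f 0%N = 0%N by [].
  have f3 : f (3 * n)%N = 0%N by rewrite /f /corner_x; do 2?case: ifP; lia.
  have cn : c n = u ^+ n by rewrite /c fn f'n expg0 mulg1.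
  have Hc0 : H (c 0%N) by rewrite /c f0 expg0 mul1g; apply: subgroupX.
  have Hc3 : H (c (3 * n)%N) by rewrite /c f3 expg0 mul1g; apply: subgroupX.
  have n3 : (n <= 3 * n)%N by lia.
  rewrite -cn; apply: (KP (3 * n)%N c _ Hc0 Hc3 n n3).
  move=> i k ik; pose a := (f' (i + k) - f' i)%N.
  have [f'le bounds] := corner_bounds ik.
  have f'E : f' (i + k)%N = (f' i + a)%N by rewrite /a subnKC.
  have diff : exists b : nat, [/\ (a + b <= 2 * k)%N, (k <= 3 * (a + b))%N &
      dist (c i) (c (i + k)%N) = len (h ^+ a * u ^+ b) \/
      dist (c i) (c (i + k)%N) = len (h ^+ a * u ^- b)].
    have dE : dist (c i) (c (i + k)%N) = len (h ^+ a * (u ^- f i * u ^+ f (i + k)%N)).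
      by rewrite /dist /c f'E flat_difference.
    have [le|lt] := leqP (f i) (f (i + k)%N).
      exists (f (i + k) - f i)%N; move: bounds; rewrite (maxn_idPr le) (minn_idPl le).
      case=> b1 b2; split=> //; left; rewrite dE -{1}(subnKC le) expgnDr mulKg //.
    exists (f i - f (i + k))%N; move: bounds.
    rewrite (maxn_idPl (ltnW lt)) (minn_idPr (ltnW lt)) => -[b1 b2]; split=> //.
    by right; rewrite dE -{1}(subnKC (ltnW lt)) expgnDr invgM mulgVK.
  have [b [ab kab dE]] := diff.
  have [fl1 fl2] := flat a b.
  have up : (dist (c i) (c (i + k)%N) <= a * len h + b * len u)%N.
    by case: dE => ->; rewrite (leq_trans (lenM _ _)) // ?lenV leq_add ?lenX.
  have lo : (a + b <= A * dist (c i) (c (i + k)%N))%N by case: dE => ->.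
  move: (dist _ _) up lo => d up lo; split; last nia.
  rewrite /L; nia.
have [h' h'H h'K] : exists2 h' : nat -> raag e, (forall n, H (h' n)) &
    forall n, (len (u ^- n * h' n) <= K)%N.
  have ex n : exists h', H h' /\ (dist (u ^+ n) h' <= K)%N.
    by have [h' ? ?] := near n; exists h'.
  have [h' h'P] := choice ex.
  by exists h' => n; have [] := h'P n.
have [i [j [ij fij]]] := ball_collision h'K.
exists (j - i)%N; first by rewrite subn_gt0.
suff -> : u ^+ (j - i) = h' j * (h' i)^-1.
  by apply: subgroupM => //; exact: subgroupV.
apply: (mulIg (h' i)); rewrite mulgVK; apply: (mulgI (u ^- j)).
by rewrite -fij mulgA -{1}(subnK (ltnW ij)) expgnDr invgM mulgVK.
Qed.

Lemma orthogonal_disjoint S T v : (forall u v, S u -> T v -> e u v) -> S v -> ~~ T v.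
Proof. by move=> ST Sv; apply/negP => /(ST _ _ Sv); rewrite adj_irr. Qed.

(** The retractions to S and to T each kill one factor. *)
Lemma len_orthogonal S T a b : (forall u v, S u -> T v -> e u v) ->
  parab S a -> parab T b -> (len a <= len (a * b))%N /\ (len b <= len (a * b))%N.
Proof.
move=> ST Sa Tb; have dis := orthogonal_disjoint ST.
have rS : ret S b = 1.
  by apply: ret_disjoint Tb => v Tv; apply/negP => /dis; rewrite Tv.
have rT : ret T a = 1 by apply: ret_disjoint Sa => v; exact: dis.
split; first by have := len_ret S (a * b); rewrite retM rS mulg1 Sa.
by have := len_ret T (a * b); rewrite retM rT mul1g Tb.
Qed.

Section Flats.
Variables (S T : pred V) (a b : raag e).
Hypotheses (ST : forall u v, S u -> T v -> e u v) (Sa : parab S a) (Tb : parab T b).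
Hypotheses (a1 : a <> 1) (b1 : b <> 1).

Lemma flat_left H : is_subgroup H -> discrete_morse H -> H a ->
  exists2 p, (0 < p)%N & H (b ^+ p).
Proof.
move=> Hs Hm Ha; apply: (morse_flat (A := 2) Hs Hm Ha); first exact: commute_parab ST Sa Tb.
have la := len_power_ge _ a1; have lb := len_power_ge _ b1.
move=> n m; split.
  have [] := len_orthogonal ST (parabX n Sa) (parabX m Tb).
  move: (la n) (lb m); move: (len _) (len _) (len _) => *; lia.
have [] := len_orthogonal ST (parabX n Sa) (parabV (parabX m Tb)).
rewrite lenV; move: (la n) (lb m); move: (len _) (len _) (len _) => *; lia.
Qed.

Lemma flat_diagonal H : is_subgroup H -> discrete_morse H -> H (a * b) ->
  exists2 p, (0 < p)%N & H (a ^+ p).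
Proof.
move=> Hs Hm Hab; have ab : commute a b by exact: commute_parab ST Sa Tb.
apply: (morse_flat (A := 3) Hs Hm Hab).
  by apply/commute_sym/commuteM.
have la := len_power_ge _ a1; have lb := len_power_ge _ b1.
move=> n m; rewrite expgMn //; split.
  have -> : a ^+ n * b ^+ n * a ^+ m = a ^+ (n + m) * b ^+ n.
    by rewrite -mulgA -[b ^+ n * _](commuteX2 m n ab) mulgA -expgnDr.
  have [] := len_orthogonal ST (parabX (n + m) Sa) (parabX n Tb).
  move: (la (n + m)%N) (lb n); move: (len _) (len _) (len _) => *; lia.
have -> : a ^+ n * b ^+ n * a ^- m = a ^+ n * a ^- m * b ^+ n.
  by rewrite -!mulgA; congr (_ * _); exact: (commuteV (commuteX2 n m (commute_sym ab))).
have Saa : parab S (a ^+ n * a ^- m) by apply: parabM; [|apply: parabV]; exact: parabX.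
have [] := len_orthogonal ST Saa (parabX n Tb).
have : (m - n <= len (a ^+ n * a ^- m))%N.
  have [mn|nm] := leqP m n; first lia.
  rewrite -{2}(subnK (ltnW nm)) expgnDr invgM mulgA mulgV mul1g lenV.
  exact: la.
move: (lb n); move: (len _) (len _) (len _) => *; lia.
Qed.

End Flats.

Lemma gen_neq1 v : raag_gen e v <> 1.
Proof.
move=> v1; have := sep_edge (dual (1 : raag e) (v, false)) 1 (v, false).
by rewrite eqxx el_gen v1 mulg1 sep_xx.
Qed.

Hypothesis e_conn : forall u v, connect e u v.

(** Powers of adjacent vertices span planes, and the graph is connected. *)
Lemma vertex_powers H v p : is_subgroup H -> discrete_morse H ->
  (0 < p)%N -> H (raag_gen e v ^+ p) ->
  forall u, exists2 p, (0 < p)%N & H (raag_gen e u ^+ p).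
Proof.
move=> Hs Hm p0 Hp u; have /connectP [s] := e_conn v u.
elim: s v p p0 Hp => [|v' s IH] v p p0 Hp /=; first by move=> _ ->; exists p.
case/andP => vv' sP uE.
have [||||| p' p'0 Hp'] := @flat_left (pred1 v) (pred1 v') (raag_gen e v ^+ p) (raag_gen e v')
  _ _ _ _ _ H Hs Hm Hp.
- by move=> ? ? /eqP -> /eqP ->.
- by apply: parabX; apply: (@parab_letter _ e _ (v, false)); exact: eqxx.
- by apply: (@parab_letter _ e _ (v', false)); exact: eqxx.
- by move=> h; have := len_power_ge p (@gen_neq1 v); rewrite h len1 leqNgt p0.
- exact: gen_neq1.
exact: IH p'0 Hp' sP uE.
Qed.

(** Passing from [g] to [g * s] for a generator [s] leaves the power of [s]
    in the conjugate of [H] unchanged, and that power yields the others. *)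
Lemma vertex_powers_conj H g0 v p : is_subgroup H -> discrete_morse H ->
  (0 < p)%N -> conjugate_set g0 H (raag_gen e v ^+ p) ->
  forall g u, exists2 p, (0 < p)%N & H (g * raag_gen e u ^+ p * g^-1).
Proof.
move=> Hs Hm p0 Hp g; rewrite -(mulVKg g0 g); have [w <-] := el_surj (g0^-1 * g).
elim/last_ind: w => [|w a IH] u.
  rewrite mulg1; exact: (vertex_powers (subgroup_conj g0 Hs) (morse_conj g0 Hm) p0 Hp).
have [p1 p10 Hp1] := IH a.1.
apply: (@vertex_powers (conjugate_set (g0 * el (rcons w a)) H) a.1 p1
  (subgroup_conj _ Hs) (morse_conj _ Hm) p10).
rewrite /conjugate_set /= -cats1 el_cat !mulgA; move: Hp1.
have : commute (raag_gen e a.1 ^+ p1) (el [:: a]).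
  case: a => v' b /=; rewrite el_letter.
  have cX : commute (raag_gen e v' ^+ p1) (raag_gen e v').
    exact/commute_sym/commuteX/commute_refl.
  by case: b => //; apply: commuteV.
move=> cm; rewrite -[_ * el [:: a] * _]mulgA -cm !invgM !mulgA.
by rewrite mulgK.
Qed.

Lemma dist_prefix x w i k : (dist (x * el (take i w)) (x * el (take (i + k) w) : raag e) <= k)%N.
Proof.
rewrite takeD el_cat mulgA -{1}[x * _]mulg1 distMl dist1.
by rewrite (leq_trans (len_el _ _)) // size_take_min geq_minl.
Qed.

(** Let [x] be nearest to [H] among the points [x0 * s ^+ n] of a half-line. The
    path from [H] to [x], along the half-line, and back to [H] by a translate of
    the first leg is a quasigeodesic with constants independent of [x0]. *)
Lemma dense_of_vertex_powers H v : is_subgroup H -> discrete_morse H ->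
  (forall g, exists2 p, (0 < p)%N & H (g * raag_gen e v ^+ p * g^-1)) ->
  exists K, forall x, exists2 h, H h & (dist x h <= K)%N.
Proof.
move=> Hs Hm powers; have [K KP] := Hm 3%N; exists K => x0.
set s := raag_gen e v.
have ex : exists n, `[< exists t h, H h /\ dist (x0 * s ^+ t) h = n >].
  exists (dist (x0 * s ^+ 0) 1); apply/asboolP; exists 0%N, 1; split=> //; exact: Hs.1.
case: (ex_minnP ex) => D /asboolP[t [h0 [Hh0 hD]]] Dmin.
set x := x0 * s ^+ t in hD.
have far i h : H h -> (D <= dist (x * s ^+ i) h)%N.
  move=> Hh; apply: Dmin; apply/asboolP; exists (t + i)%N, h; split=> //.
  by rewrite /x expgnDr mulgA.
(* The leg along the line is long compared with the two legs of length [D], and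
   long enough for a translate of it to contain [x0]. *)
have [p p0 Hp] := powers x; pose N := (p * (4 * D + t))%N.
have N4 : (4 * D + t <= N)%N by rewrite leq_pmull.
pose y := x * s ^+ N * x^-1.
have Hy : H y.
  have := zpow_conj (s ^+ p) x (Posz (4 * D + t)%N); rewrite !zpow_nat -expgnA -/N -/y => <-.
  exact: subgroupX.
have [w wE lw] := geodesic_word (h0^-1 * x).
have wD : size w = D by rewrite lw -hD distC.
have xE : x = h0 * el w by rewrite wE mulVKg.
pose path : word V := w ++ (nseq N (v, false) ++ word_inv w).
pose c i := h0 * el (take i path).
have elN j : el (nseq j (v, false)) = s ^+ j :> raag e.
  by elim: j => //= j IH; rewrite el_cons IH expgS.
have size_inv : size (word_inv w) = D by rewrite /word_inv size_rev size_map.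
have c1 i : (i <= D)%N -> c i = h0 * el (take i w).
  by move=> iD; rewrite /c takel_cat // wD.
have c2 j : (j <= N)%N -> c (D + j)%N = x * s ^+ j.
  move=> jN; rewrite /c -wD takeD take_size_cat // drop_size_cat // takel_cat ?size_nseq //.
  by rewrite take_nseq // el_cat elN mulgA -xE.
have c3 j : (j <= D)%N -> c (D + N + j)%N = y * (h0 * el (take (D - j) w)).
  move=> jD; rewrite /c takeD el_cat mulgA -/(c _) c2 // /path catA.
  rewrite drop_size_cat; last by rewrite size_cat size_nseq wD.
  have -> : take j (word_inv w) = word_inv (drop (D - j) w).
    rewrite /word_inv take_rev size_map wD; congr rev.
    by rewrite map_drop.
  have wS : el w = el (take (D - j) w) * el (drop (D - j) w) :> raag e.
    by rewrite -el_cat cat_take_drop.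
  rewrite el_inv /y -[RHS]mulgA; congr (_ * _).
  by rewrite xE wS !invgM -!mulgA mulKg mulVg mulg1.
have lip i k : (dist (c i) (c (i + k)%N) <= k)%N by exact: dist_prefix.
have d0 i : (i <= D)%N -> (dist h0 (c i) <= i)%N.
  by move=> iD; have := lip 0%N i; rewrite add0n /c take0 mulg1.
have dx i : (i <= D)%N -> (dist (c i) x <= D - i)%N.
  move=> iD; have := lip i (D - i)%N; rewrite subnKC //.
  by have := c2 0%N isT; rewrite addn0 mulg1 => ->.
have dyx j : (j <= D)%N -> (dist (x * s ^+ N) (c (D + N + j)%N) <= j)%N.
  by move=> jD; have := lip (D + N)%N j; rewrite c2.
have dyh j : (j <= D)%N -> (dist (c (D + N + j)%N) (y * h0) <= D - j)%N.
  move=> jD; have := lip (D + N + j)%N (D - j)%N.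
  rewrite (_ : (D + N + j + (D - j) = D + N + D)%N); last lia.
  by rewrite [c (D + N + D)%N]c3 // subnn take0 mulg1.
have line i j : (i <= j)%N -> (j - i <= dist (x * s ^+ i) (x * s ^+ j))%N.
  move=> ij; rewrite distMl /dist -(subnKC ij) expgnDr mulKg subnKC //.
  exact: (len_power_ge _ (@gen_neq1 v)).
have Hyh : H (y * h0) by exact: subgroupM.
have quasi i k : (i + k <= D + N + D)%N -> (k <= 3 * dist (c i) (c (i + k)%N))%N.
  move=> ik; set j := (i + k)%N; set d := dist _ _.
  have [iD|Di] := leqP i D; have [jD|Dj] := leqP j D; last 1 first.
  - have [i' iE] : exists i', i = (D + i')%N by exists (i - D)%N; lia.
    have [j' jE] : exists j', j = (D + j')%N by exists (j - D)%N; lia.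
    have [iN|Ni] := leqP i' N; have [jN|Nj] := leqP j' N; last 1 first.
    + have [i2 i2E] : exists i2, i = (D + N + i2)%N by exists (i' - N)%N; lia.
      have [j2 j2E] : exists j2, j = (D + N + j2)%N by exists (j' - N)%N; lia.
      have h1 : (dist (x * s ^+ N) (c i) <= i2)%N by rewrite i2E dyx; lia.
      have h2 : (dist (c j) (y * h0) <= D - j2)%N by rewrite j2E dyh; lia.
      have h3 := far N (y * h0) Hyh.
      have := dist_triangle (c i) (x * s ^+ N) (y * h0).
      have := dist_triangle (c j) (c i) (y * h0).
      rewrite -/d; lia.
    + have := line i' j'; rewrite -!c2 // -iE -jE -/d; lia.
    + have [j2 j2E] : exists j2, j = (D + N + j2)%N by exists (j' - N)%N; lia.
      have h1 : (dist (x * s ^+ N) (c j) <= j2)%N by rewrite j2E dyx; lia.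
      have h2 : (dist (c j) (y * h0) <= D - j2)%N by rewrite j2E dyh; lia.
      have h3 : (D <= dist (c i) (y * h0))%N by rewrite iE c2 //; exact: far.
      have h4 : (N - i' <= dist (c i) (x * s ^+ N))%N by rewrite iE c2 // line.
      have := dist_triangle (c j) (c i) (y * h0).
      have := dist_triangle (c j) (c i) (x * s ^+ N).
      rewrite -/d (distC (c j)); lia.
    + lia.
  - have h1 : (dist h0 (c i) <= i)%N by exact: d0.
    have h2 : (dist (c j) x <= D - j)%N by exact: dx.
    have h3 := far 0%N h0 Hh0; rewrite mulg1 distC in h3.
    have := dist_triangle (c i) h0 x; have := dist_triangle (c j) (c i) x.
    rewrite -/d; lia.
  - have [j' jE] : exists j', j = (D + j')%N by exists (j - D)%N; lia.
    have h1 : (dist h0 (c i) <= i)%N by exact: d0.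
    have h2 : (dist (c i) x <= D - i)%N by exact: dx.
    have [jN|Nj] := leqP j' N.
      have h3 : (D <= dist (c j) h0)%N by rewrite jE c2 //; exact: far.
      have h4 : (j' <= dist x (c j))%N.
        by rewrite jE c2 //; have := line 0%N j'; rewrite mulg1 subn0; apply.
      have := dist_triangle (c i) (c j) h0; have := dist_triangle (c i) x (c j).
      rewrite (distC (c j) (c i)) (distC (c i) h0) (distC x (c i)) -/d; lia.
    have [j2 j2E] : exists j2, j = (D + N + j2)%N by exists (j' - N)%N; lia.
    have h3 : (dist (x * s ^+ N) (c j) <= j2)%N by rewrite j2E dyx; lia.
    have h4 : (N <= dist x (x * s ^+ N))%N.
      by have := line 0%N N; rewrite mulg1 subn0; apply.
    have := dist_triangle (c i) x (x * s ^+ N).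
    have := dist_triangle (c j) (c i) (x * s ^+ N).
    rewrite (distC x (c i)) (distC (c j)) -/d; lia.
  - lia.
have [||||h Hh hK] := KP (D + N + D)%N c _ _ _ (D + (N - t))%N.
- by move=> i k ik; have := lip i k; have := quasi i k ik; lia.
- by rewrite /c take0 mulg1.
- by rewrite c3 // subnn take0 mulg1.
- lia.
exists (y^-1 * h); first by apply: subgroupM => //; exact: subgroupV.
(* The translate of [x0] by [y] lies on the path. *)
rewrite -(distMl y) mulVKg (_ : y * x0 = c (D + (N - t))%N) //.
rewrite c2; last lia.
have tN : (t <= N)%N by lia.
rewrite /y -(subnK tN) expgnDr /x !invgM !mulgA subnK //.
by rewrite mulgVK mulgK.
Qed.

(** A point at distance at most [K] from H gives a representative of its coset in
    the ball of radius [K]. *)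
Lemma dense_finite_index H : is_subgroup H ->
  (exists K, forall x, exists2 h, H h & (dist x h <= K)%N) -> finite_index H.
Proof.
move=> Hs [K KP]; rewrite /finite_index.
apply: (@sub_finite_set _ _ ((fun g => [set g * h | h in H]) @` [set g | (len g <= K)%N])).
  move=> _ [g _ <-]; have [h Hh hK] := KP g^-1.
  exists (g * h); first by move: hK; rewrite /dist invgK.
  apply/seteqP; split=> _ [k Hk <-].
    by exists (h * k); rewrite ?mulgA //; apply: subgroupM.
  exists (h^-1 * k); last by rewrite !mulgA mulgK.
  by apply: subgroupM => //; exact: subgroupV.
exact/finite_image/finite_ball.
Qed.

Theorem morse_finite_index H g v p : is_subgroup H -> discrete_morse H ->
  (0 < p)%N -> conjugate_set g H (raag_gen e v ^+ p) -> finite_index H.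
Proof.
move=> Hs Hm p0 Hp; apply: dense_finite_index => //.
apply: (dense_of_vertex_powers (v := v) Hs Hm) => g'.
exact: vertex_powers_conj Hs Hm p0 Hp g' v.
Qed.

End Morse.

Arguments discrete_morse {V e} H.
Arguments conjugate_set {V e} g%_group_scope H.

(** * Freeness *)

Section Free.
Variables (V : finType) (e : simple_graph V).
Implicit Types (g h k s t x y l : raag e) (S : pred V) (u v : V) (w : word V).
Variable H : set (raag e).
Hypothesis H_sub : is_subgroup H.
Hypothesis H_links : forall v g x, parab (e v) x -> H (g * x * g^-1) -> x = 1.

Let vtx v : raag e := raag_gen e v.

Definition rank v : nat := enum_rank v.
Definition below n : pred V := fun v => rank v < n.
(** Adding the vertices in order of rank builds the group by HNN extensions: the
    stable letter [v] centralises the subgroup generated by [lower_link v]. *)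
Definition lower_link v : pred V := fun u => e v u && (rank u < rank v).

Lemma rank_inj : injective rank.
Proof. by move=> u v /val_inj/enum_rank_inj. Qed.

Lemma belowS n v : below n.+1 v = (rank v == n) || below n v.
Proof. by rewrite /below ltnS leq_eqVlt. Qed.

Lemma parab_sub S (S' : pred V) x : (forall v, S v -> S' v) -> parab S x -> parab S' x.
Proof.
move=> SS /parab_word [w <- Sw]; apply: parab_el; apply/allP => a /(allP Sw).
exact: SS.
Qed.

Lemma lower_link_triv v g x : parab (lower_link v) x -> H (g * x * g^-1) -> x = 1.
Proof. by move=> px; apply: (@H_links v); apply: parab_sub px => u /andP[]. Qed.

Lemma vtx_commute v l : parab (lower_link v) l -> commute l (vtx v).
Proof.
move=> pl; apply: (commute_parab (S := lower_link v) (T := pred1 v)) => //.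
  by move=> u v' /andP[+ _] /eqP ->; rewrite adj_sym.
by apply: (@parab_letter _ e _ (v, false)); exact: eqxx.
Qed.

(** ** An equivariant choice of one point in each coset *)

Definition double_coset v g : set (raag e) :=
  [set d | exists h l, [/\ H h, parab (lower_link v) l & d = h * g * l]].

Lemma double_coset_eq v g h l : H h -> parab (lower_link v) l ->
  double_coset v (h * g * l) = double_coset v g.
Proof.
move=> Hh pl; apply/seteqP; split=> d [h' [l' [Hh' pl' ->]]].
  exists (h' * h), (l * l'); split; [exact: subgroupM|exact: parabM|].
  by rewrite !mulgA.
exists (h' * h^-1), (l^-1 * l'); split.
- by apply: subgroupM => //; exact: subgroupV.
- by apply: parabM => //; exact: parabV.
- by rewrite !mulgA mulgVK mulgK.
Qed.

(** The choice depends only on the H-orbit of the coset of [g]. *)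
Definition orbit_point v g := xget 1 (double_coset v g).

Lemma orbit_pointP v g : double_coset v g (orbit_point v g).
Proof.
apply: (@xgetPex _ 1); exists (1 * g * 1), 1, 1; split=> //; first exact: H_sub.1.
exact: parab1.
Qed.

(** The point of the coset of [g] that lies in the H-orbit of the chosen point. It
    is unique because H acts freely on these cosets, so it is equivariant. *)
Definition is_coset_point v g s :=
  coset (lower_link v) g s /\ exists2 h, H h & orbit_point v g = h * s.

Lemma coset_point_exists v g : exists s, is_coset_point v g s.
Proof.
have [h [l [Hh pl rE]]] := orbit_pointP v g; exists (g * l); split.
  by rewrite /coset /= mulKg.
by exists h; rewrite // mulgA.
Qed.

Lemma coset_point_unique v g s s' : is_coset_point v g s -> is_coset_point v g s' -> s = s'.
Proof.
move=> [cs [h Hh rE]] [cs' [h' Hh' rE']].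
rewrite /coset /= in cs cs'.
have ps : parab (lower_link v) (s^-1 * s').
  rewrite (_ : _ * _ = (g^-1 * s)^-1 * (g^-1 * s')); last by rewrite invgM invgK mulgA mulgK.
  by apply: parabM => //; exact: parabV.
have sE : s' = h'^-1 * h * s by rewrite -mulgA -rE rE' mulKg.
have := lower_link_triv (g := s) ps.
rewrite mulVKg sE mulgK => h1; symmetry; apply: (mulgI s^-1); rewrite mulVg.
rewrite -sE {1}sE in h1 *; rewrite sE; apply: h1.
by apply: subgroupM => //; exact: subgroupV.
Qed.

Definition coset_point v g := xget 1 (is_coset_point v g).

Lemma coset_pointP v g : is_coset_point v g (coset_point v g).
Proof. by apply: (@xgetPex _ 1); exact: coset_point_exists. Qed.

Lemma coset_pointE v g s : is_coset_point v g s -> coset_point v g = s.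
Proof. exact/coset_point_unique/coset_pointP. Qed.

Lemma coset_point_coset v g : parab (lower_link v) (g^-1 * coset_point v g).
Proof. by have [] := coset_pointP v g. Qed.

Lemma coset_point_mul v g h l : H h -> parab (lower_link v) l ->
  coset_point v (h * g * l) = h * coset_point v g.
Proof.
move=> Hh pl; apply: coset_pointE; have [cg [k Hk rE]] := coset_pointP v g; split.
  rewrite /coset /= (_ : _ * _ = l^-1 * (g^-1 * coset_point v g)).
    by apply: parabM => //; exact: parabV.
  by rewrite !invgM !mulgA mulgVK.
exists (k * h^-1); first by apply: subgroupM => //; exact: subgroupV.
by rewrite /orbit_point double_coset_eq // -/(orbit_point v g) rE mulgA mulgVK.
Qed.

Lemma coset_point_H v g h : H h -> coset_point v (h * g) = h * coset_point v g.
Proof. by move=> Hh; rewrite -[h * g]mulg1 coset_point_mul //; exact: parab1. Qed.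

Lemma coset_point_link v g l : parab (lower_link v) l -> coset_point v (g * l) = coset_point v g.
Proof.
by move=> pl; rewrite -[g]mul1g coset_point_mul // ?mul1g //; exact: H_sub.1.
Qed.

Lemma coset_point_idem v g : coset_point v (coset_point v g) = coset_point v g.
Proof. by rewrite -{2}(coset_point_link g (coset_point_coset v g)) mulVKg. Qed.

(** The edges from [s] to [s * vtx v] with [s] the chosen point of its coset
    form a spanning tree of the Cayley graph, invariant under H. *)
Definition tree_edge v s := coset_point v s = s.

Lemma tree_edge_H v s h : H h -> tree_edge v s -> tree_edge v (h * s).
Proof. by move=> Hh ts; rewrite /tree_edge coset_point_H // ts. Qed.

(** ** Connectedness of the tree *)

(** By induction on the rank of the labels in use: an edge labelled [v] can be
    slid inside its coset to the tree edge, along paths with labels of smaller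
    rank. *)
Lemma tree_connected (Q : set (raag e)) :
  (forall v s, tree_edge v s -> (Q s <-> Q (s * vtx v))) -> forall g g', Q g -> Q g'.
Proof.
move=> edge; suff key n g l : parab (below n) l -> Q g -> Q (g * l).
  move=> g g' Qg; rewrite -(mulVKg g g'); apply: (key #|V|) => //.
  have [w <-] := el_surj (g^-1 * g'); apply: parab_el; apply/allP => a _.
  exact: ltn_ord.
elim: n g l => [|n IH] g l /parab_word [w <-].
  by case: w => [|a w] /=; rewrite ?mulg1 // /below ltn0.
have step v x : below n.+1 v -> Q x <-> Q (x * vtx v).
  rewrite /below ltnS leq_eqVlt => /orP[/eqP vn|vn]; last first.
    have pv : parab (below n) (vtx v) by exact: (@parab_letter _ e _ (v, false)).
    split; first exact: IH.
    by rewrite -{2}(mulgK (vtx v) x); apply: IH; exact: parabV.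
  have px : parab (below n) (x^-1 * coset_point v x).
    by apply: parab_sub (coset_point_coset v x) => u /andP[_]; rewrite /below vn.
  have cm := vtx_commute (coset_point_coset v x).
  have e1 : coset_point v x = x * (x^-1 * coset_point v x) by rewrite mulVKg.
  have e2 : coset_point v x * vtx v = x * vtx v * (x^-1 * coset_point v x).
    by rewrite -mulgA -cm mulgA -e1.
  have e3 := edge v (coset_point v x) (coset_point_idem v x).
  split=> Qx.
    have : Q (coset_point v x * vtx v) by apply/e3; rewrite e1; exact: IH.
    by rewrite e2 => /(IH _ _ (parabV px)); rewrite mulgK.
  have : Q (coset_point v x) by apply/e3; rewrite e2; exact: IH.
  by rewrite {1}e1 => /(IH _ _ (parabV px)); rewrite mulgK.
elim: w g => [|[v b] w IHw] g /=; first by rewrite mulg1.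
case/andP=> nv nw Qg; rewrite el_cons mulgA; apply: IHw => //.
rewrite el_letter; case: b; last exact/(step v g nv).
by apply/(step v _ nv); rewrite mulgVK.
Qed.

(** ** Potentials on the tree *)

Section Potential.
Variables (A : groupType) (lab : V -> raag e -> A).
Hypothesis lab_H : forall v s h, H h -> lab v (h * s) = lab v s.
Implicit Type mu : V -> raag e -> A.

Definition increment mu x (a : V * bool) : A :=
  if a.2 then (mu a.1 (x * el [:: a]))^-1 else mu a.1 x.

Fixpoint path_sum mu x w : A :=
  if w is a :: w' then increment mu x a * path_sum mu (x * el [:: a]) w' else 1.

Lemma path_sum_cat mu x w w' :
  path_sum mu x (w ++ w') = path_sum mu x w * path_sum mu (x * el w) w'.
Proof.
elim: w x => [|a w IH] x /=; first by rewrite mul1g mulg1.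
by rewrite IH (el_cons _ a w) !mulgA.
Qed.

(** A labelling of the edges of the Cayley graph whose labels are among the
    first n vertices, without holonomy around commutation squares. *)
Definition flat_below n mu := forall u v x, below n u -> below n v -> e u v ->
  mu u x * mu v (x * vtx u) = mu v x * mu u (x * vtx v).

Lemma path_sum_eq n mu x w w' : flat_below n mu ->
  word_eq (raag_relators e) w w' ->
  path_sum mu x (ret_word (below n) w) = path_sum mu x (ret_word (below n) w').
Proof.
move=> sq; elim=> {w w'}[|w w' _ -> //|w w' w'' _ -> _ -> //|w w' v b|w w' r] //.
  rewrite !ret_word_cat /=; case: (below n v) => //=.
  rewrite !path_sum_cat /=; congr (_ * _).
  move: (x * _) => y.
  have yE : y * el [:: (v, b)] * el [:: (v, ~~ b)] = y.
    by rewrite -(el_letterV _ v b) mulgK.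
  by case: b yE => /= yE; rewrite /increment /= yE mulgA ?mulgV ?mulVg mul1g.
case=> u [v [uv ->]]; rewrite !ret_word_cat !path_sum_cat.
move: (x * _) => y; congr (_ * _).
have := @el_relator _ e _ (ex_intro _ u (ex_intro _ v (conj uv erefl))).
set r0 := [:: _; _; _; _] => r1.
have r1' : el (ret_word (below n) r0) = 1 :> raag e by rewrite -ret_el r1 (morph1 (@retM _ e _)).
rewrite r1' mulg1; suff -> : path_sum mu y (ret_word (below n) r0) = 1 by rewrite mul1g.
rewrite /r0 /=; case nu: (below n u); case nv: (below n v) => //=.
- rewrite /increment /= mulg1; set z := y * el [:: (u, true)] * el [:: (v, true)].
  have -> : y * el [:: (u, true)] = z * vtx v.
    by rewrite /z -(el_letterV _ v false) mulgVK.
  by rewrite el_gen mulgA -invgM (sq u v) // mulVg.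
- rewrite /increment /= mulg1 -(el_letterV _ u false) mulVg //.
- rewrite /increment /= mulg1 -(el_letterV _ v false) mulVg //.
Qed.

(** For flat [mu], the product of [mu] along any path from [x] to [x * g] with
    labels below n. *)
Definition potential n mu x g := path_sum mu x (ret_word (below n) (pg_repr g)).

Section PotentialBelow.
Variables (n : nat) (mu : V -> raag e -> A).
Hypothesis flat_mu : flat_below n mu.

Lemma potential_word x w : all (fun a => below n a.1) w ->
  potential n mu x (el w) = path_sum mu x w.
Proof.
move=> /all_filterP wn; rewrite -[in RHS]wn; apply: path_sum_eq => //.
by apply/elP; rewrite /el pg_reprK.
Qed.

Lemma potential1 x : potential n mu x 1 = 1.
Proof. by rewrite -(el_nil e) potential_word. Qed.

Lemma potential_gen x v : below n v -> potential n mu x (vtx v) = mu v x.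
Proof. by move=> nv; rewrite -[vtx v]/(el [:: (v, false)]) potential_word /= ?nv // mulg1. Qed.

Lemma potentialM x g g' : parab (below n) g -> parab (below n) g' ->
  potential n mu x (g * g') = potential n mu x g * potential n mu (x * g) g'.
Proof.
move=> /parab_word [w <- nw] /parab_word [w' <- nw'].
by rewrite -el_cat !potential_word ?all_cat ?nw // path_sum_cat.
Qed.

Lemma potential_H x g h : (forall v y, below n v -> mu v (h * y) = mu v y) ->
  potential n mu (h * x) g = potential n mu x g.
Proof.
move=> mu_h; rewrite /potential; have := filter_all (fun a : V * bool => below n a.1) (pg_repr g).
rewrite -/(ret_word _ _); elim: (ret_word _ _) x => //= a w IH x /andP[na nw].
by rewrite -mulgA IH // /increment -!mulgA !mu_h.
Qed.

End PotentialBelow.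

(** The value on an edge labelled [v] is forced: slide the edge to the tree edge
    of its coset, use the prescribed label there, and slide back. *)
Lemma flat_labelling n : exists mu, [/\ flat_below n mu,
    forall v h x, below n v -> H h -> mu v (h * x) = mu v x &
    forall v s, below n v -> tree_edge v s -> mu v s = lab v s].
Proof.
elim: n => [|n [mu [sq muH mulab]]]; first by exists (fun _ _ => 1); split.
pose link v x := x^-1 * coset_point v x.
pose new v x := potential n mu x (link v x) * lab v (coset_point v x) *
                potential n mu (coset_point v x * vtx v) (link v x)^-1.
exists (fun v => if rank v == n then new v else mu v).
have linkn v x : rank v == n -> parab (below n) (link v x).
  move=> /eqP vn; apply: parab_sub (coset_point_coset v x) => u /andP[_].
  by rewrite /below vn.
have newE u v x : below n u -> rank v == n -> e u v ->
    mu u x * new v (x * vtx u) = new v x * mu u (x * vtx v).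
  move=> nu vn uv; have pu : parab (below n) (vtx u).
    exact: (@parab_letter _ e _ (u, false)).
  have pl : parab (lower_link v) (vtx u).
    by apply: (@parab_letter _ e _ (u, false)); rewrite /lower_link /= adj_sym uv (eqP vn).
  have secu : coset_point v (x * vtx u) = coset_point v x by exact: coset_point_link.
  have linku : link v (x * vtx u) = (vtx u)^-1 * link v x.
    by rewrite /link secu invgM mulgA.
  rewrite /new secu linku -(potential_gen sq _ nu) 2![potential n mu x (vtx u) * _]mulgA.
  rewrite -(potentialM sq) //; last by apply: parabM; [exact: parabV|exact: linkn].
  rewrite mulVKg -!mulgA; congr (_ * (_ * _)).
  rewrite invgM invgK potentialM //; last by apply: parabV; exact: linkn.
  congr (_ * _); rewrite -(potential_gen sq _ nu); congr potential.
  have := commuteV (commute_sym (vtx_commute (coset_point_coset v x))); rewrite -/(link v x) => cm.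
  by rewrite -mulgA cm mulgA /link invgM invgK mulVKg.
split.
- move=> u v x; rewrite !belowS.
  case un: (rank u == n); case vn: (rank v == n) => //=.
  + have -> : u = v by apply: rank_inj; rewrite (eqP un) (eqP vn).
    by rewrite adj_irr.
  + by move=> _ nv uv; rewrite newE // adj_sym.
  + by move=> nu _ uv; rewrite newE.
  + by move=> nu nv uv; apply: sq.
- move=> v h x; rewrite belowS; case vn: (rank v == n) => /= nv Hh; last exact: muH.
  have linkh : link v (h * x) = link v x by rewrite /link coset_point_H // invgM mulgA mulgVK.
  have muh : forall v' y, below n v' -> mu v' (h * y) = mu v' y.
    by move=> v' y nv'; exact: muH.
  by rewrite /new linkh coset_point_H // lab_H // -[h * _ * vtx v]mulgA !(potential_H _ _ muh).
- move=> v s; rewrite belowS; case vn: (rank v == n) => /= nv ts; last exact: mulab.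
  by rewrite /new /link ts mulVg invg1 !potential1 // mul1g mulg1.
Qed.

(** Every invariant labelling of the tree is the coboundary of a function on
    the vertices that restricts to a homomorphism on H; this is the absence of
    cycles. *)
Lemma potential_exists : exists P : raag e -> A,
  [/\ {in H & setT, forall h g, P (h * g) = P h * P g} &
      forall v s, tree_edge v s -> P (s * vtx v) = P s * lab v s].
Proof.
have [mu [sq muH mulab]] := flat_labelling #|V|.
have all_below g : parab (below #|V|) g.
  by have [w <-] := el_surj g; apply: parab_el; apply/allP => a _; exact: ltn_ord.
exists (potential #|V| mu 1); split=> [h g /set_mem Hh _|v s ts].
  rewrite potentialM // mul1g; congr (_ * _).
  by rewrite -{1}[h]mulg1 potential_H // => v y nv; exact: muH.
rewrite potentialM // mul1g potential_gen //; last exact: ltn_ord.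
by rewrite mulab //; exact: ltn_ord.
Qed.

End Potential.

(** ** A connected transversal of the tree *)

Definition neighbour x y := exists v,
  (tree_edge v x /\ y = x * vtx v) \/ (tree_edge v y /\ x = y * vtx v).

Lemma neighbour_H x y h : H h -> neighbour x y -> neighbour (h * x) (h * y).
Proof.
by move=> Hh [v [[t ->]|[t ->]]]; exists v; [left|right]; split;
  [exact: tree_edge_H|rewrite mulgA|exact: tree_edge_H|rewrite mulgA].
Qed.

Definition meets (T : set (raag e)) x := exists2 h, H h & T (h * x).

(** The neighbours of T in the H-orbit of [x]. *)
Definition candidates (T : set (raag e)) x : set (raag e) :=
  [set y | (exists2 t, T t & neighbour t y) /\ exists2 h, H h & y = h * x].

(** Breadth-first search from the identity, keeping one candidate per orbit. *)
Fixpoint layers n : set (raag e) :=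
  if n is m.+1 then
    layers m `|` [set x | [/\ ~ meets (layers m) x, x = xget 1 (candidates (layers m) x)
                           & exists2 t, layers m t & neighbour t x]]
  else [set 1].

Definition transversal : set (raag e) := [set x | exists n, layers n x].

Lemma candidates_H T x h : H h -> candidates T (h * x) = candidates T x.
Proof.
move=> Hh; apply/seteqP; split=> y [ty [k Hk yE]]; (split; first exact: ty); rewrite yE.
  by exists (k * h); rewrite ?mulgA //; exact: subgroupM.
exists (k * h^-1); last by rewrite mulgA mulgVK.
by apply: subgroupM => //; exact: subgroupV.
Qed.

Lemma meets_H T x h : H h -> meets T (h * x) -> meets T x.
Proof. by move=> Hh [k Hk Tk]; exists (k * h); rewrite -?mulgA //; exact: subgroupM. Qed.

Lemma layers_mono m n x : (m <= n)%N -> layers m x -> layers n x.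
Proof. by move=> mn; rewrite -(subnK mn); elim: (n - m)%N => //= k IH /IH; left. Qed.

Lemma layers_unique n x h : layers n x -> layers n (h * x) -> H h -> h * x = x.
Proof.
elim: n => [|n IH] /=.
  by move=> -> /=.
move=> [Lx|[nx xE _]] [Lhx|[nhx hxE _]] Hh; first exact: IH.
- by case: nhx; exists h^-1; [exact: subgroupV|rewrite mulKg].
- by case: nx; exists h.
by rewrite hxE candidates_H // -xE.
Qed.

Lemma transversal_unique x h : transversal x -> transversal (h * x) -> H h -> h = 1.
Proof.
move=> [m Lm] [n Ln] Hh; apply: (mulIg x); rewrite mul1g.
apply: (@layers_unique (maxn m n)) => //.
- exact: layers_mono (leq_maxl _ _) Lm.
- exact: layers_mono (leq_maxr _ _) Ln.
Qed.

Lemma transversal_meets g : meets transversal g.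
Proof.
apply: (tree_connected (Q := meets transversal) _ (g := 1)); last first.
  by exists 1; [exact: H_sub.1|exists 0%N; rewrite /= mulg1].
suff key x y : neighbour x y -> meets transversal x -> meets transversal y.
  by move=> v s ts; split; apply: key; exists v; [left|right].
move=> xy [h Hh [n Ln]].
have [[k Hk Lk]|nmeet] := pselect (meets (layers n) (h * y)).
  by exists (k * h); [exact: subgroupM|exists n; rewrite -mulgA].
have := neighbour_H Hh xy; set x' := h * x; set y' := h * y => xy'.
have [[t Lt ty] [k Hk zE]] : candidates (layers n) y' (xget 1 (candidates (layers n) y')).
  apply: (@xgetPex _ 1); exists y'; split; first by exists x'.
  by exists 1; [exact: H_sub.1|rewrite mul1g].
set z := xget _ _ in zE ty.
exists (k * h); first exact: subgroupM.
exists n.+1; right; rewrite -mulgA -/y' -zE; split.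
- by rewrite zE => /(meets_H Hk).
- by rewrite {2}zE candidates_H.
- by exists t.
Qed.

Lemma transversal_const (A : Type) (P : raag e -> A) :
  (forall x y, transversal x -> transversal y -> neighbour x y -> P x = P y) ->
  forall t, transversal t -> P t = P 1.
Proof.
move=> Pn t [n]; elim: n t => [|n IH] t /=; first by move=> ->.
case=> [/IH //|[nm tE [t' Lt' nt]]]; rewrite -(IH t') //; symmetry; apply: Pn => //.
  by exists n.
by exists n.+1; right; split=> //; exists t'.
Qed.

Lemma deck_exists g : exists h, H h /\ transversal (h^-1 * g).
Proof.
have [h Hh Th] := transversal_meets g.
by exists h^-1; rewrite invgK; split=> //; exact: subgroupV.
Qed.

(** The element of H that brings the transversal over [g]. *)
Definition deck g := xget 1 [set h | H h /\ transversal (h^-1 * g)].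
Definition base_point g := (deck g)^-1 * g.

Lemma deckP g : H (deck g) /\ transversal (base_point g).
Proof. by have := @xgetPex _ 1 _ (deck_exists g). Qed.

Lemma deckE g h : H h -> transversal (h^-1 * g) -> deck g = h.
Proof.
move=> Hh Th; have [Hc Tc] := deckP g.
have : h^-1 * deck g = 1.
  apply: (transversal_unique Tc); first by rewrite /base_point -mulgA mulVKg.
  by apply: subgroupM => //; exact: subgroupV.
by move=> h1; apply: (mulgI h^-1); rewrite h1 mulVg.
Qed.

Lemma deck_H g h : H h -> deck (h * g) = h * deck g.
Proof.
move=> Hh; have [Hc Tc] := deckP g; apply: deckE; first exact: subgroupM.
by rewrite invgM -mulgA mulKg.
Qed.

Lemma deck_transversal t : transversal t -> deck t = 1.
Proof. by move=> Tt; apply: deckE; [exact: H_sub.1|rewrite invg1 mul1g]. Qed.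

Lemma transversal1 : transversal 1.
Proof. by exists 0%N. Qed.

Lemma deck_sub h : H h -> deck h = h.
Proof.
move=> Hh; rewrite -{1}[h]mulg1 deck_H // deck_transversal ?mulg1 //.
exact: transversal1.
Qed.

Lemma base_point_H g h : H h -> base_point (h * g) = base_point g.
Proof. by move=> Hh; rewrite /base_point deck_H // invgM -mulgA mulKg. Qed.

Lemma base_point_transversal t : transversal t -> base_point t = t.
Proof. by move=> Tt; rewrite /base_point deck_transversal // invg1 mul1g. Qed.

(** ** The free basis *)

(** The edges that start in the transversal and leave it: the classical basis
    of a group acting freely on a tree. *)
Definition leaves_transversal (p : V * raag e) : bool :=
  `[< [/\ tree_edge p.1 p.2, transversal p.2 & deck (p.2 * vtx p.1) <> 1] >].

Definition basis := {p : V * raag e | leaves_transversal p}.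

Definition basis_elt (p : basis) : raag e := deck ((val p).2 * vtx (val p).1).

Lemma no_relators (r : word basis) : @set0 (word basis) r -> word_val basis_elt r = 1.
Proof. by []. Qed.

Let ev : free_group basis -> raag e := pg_lift no_relators.

Lemma evM : {morph ev : x y / x * y}.
Proof. exact: pg_liftM. Qed.

Lemma ev_sub a : H (ev a).
Proof.
rewrite /ev /pg_lift; elim: (pg_repr a) => [|[p b] w IH].
  by rewrite word_val_nil; exact: H_sub.1.
rewrite word_val_cons; apply: subgroupM => //.
have Hp : H (basis_elt p) by have [] := deckP ((val p).2 * vtx (val p).1).
by case: b => //; exact: subgroupV.
Qed.

(** The label records the basis element of the tree edge, moved so as to start in
    the transversal; edges inside the transversal have trivial label. *)
Definition edge_label v s : free_group basis :=
  if insub (v, base_point s) is Some p then pg_gen set0 p else 1.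

Lemma edge_label_H v s h : H h -> edge_label v (h * s) = edge_label v s.
Proof. by move=> Hh; rewrite /edge_label base_point_H. Qed.

Lemma ev_label v s : tree_edge v s -> ev (edge_label v s) = deck (base_point s * vtx v).
Proof.
move=> ts; rewrite /edge_label; case: insubP => [p pb pE|nb].
  by rewrite /ev pg_lift_gen /basis_elt pE.
rewrite (morph1 evM); symmetry; apply/eqP/negPn/negP => /eqP c1.
move/negP: nb; apply; apply/asboolP; split=> //=; last by have [] := deckP s.
rewrite /base_point; apply: tree_edge_H => //; apply: subgroupV => //.
by have [] := deckP s.
Qed.

(** Let [P] be the potential of the labelling by basis elements. It inverts the
    evaluation [ev] on H: [ev] composed with [P] is [deck], having the same
    increments along the tree, and [P] composed with [ev] fixes the basis, since
    [P] is trivial on the connected transversal. *)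
Theorem free_of_trivial_intersections : is_free_subgroup H.
Proof.
exists basis, ev.
have [P [PH Pedge]] := potential_exists edge_label_H.
have PM h g : H h -> P (h * g) = P h * P g by move=> Hh; apply: PH; rewrite ?inE.
have P1 : P 1 = 1 by apply: (mulgI (P 1)); rewrite -PM ?mulg1 //; exact: H_sub.1.
have FP g : ev (P g) = deck g.
  apply: (tree_connected (Q := [set x | ev (P x) = deck x]) _ (g := 1)); last first.
    by rewrite /= P1 (morph1 evM) deck_transversal //; exact: transversal1.
  move=> v s ts /=; have [Hc _] := deckP s.
  have -> : ev (P (s * vtx v)) = ev (P s) * (deck s)^-1 * deck (s * vtx v).
    rewrite Pedge // evM ev_label // /base_point -[_ * s * _]mulgA.
    by rewrite (deck_H (s * vtx v) (subgroupV H_sub Hc)) mulgA.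
  split=> [->|h]; first by rewrite mulgV mul1g.
  apply: (mulIg (deck s)^-1); rewrite mulgV; apply: (mulIg (deck (s * vtx v))).
  by rewrite mul1g.
have Ptrans t : transversal t -> P t = 1.
  rewrite -P1; apply: transversal_const => {t}.
  suff key x v : transversal x -> transversal (x * vtx v) -> tree_edge v x ->
      P (x * vtx v) = P x.
    move=> x y Tx Ty [v [[tx yE]|[ty xE]]].
      by rewrite yE key // -yE.
    by rewrite xE key // -xE.
  move=> Tx Ty tx; rewrite Pedge // (_ : edge_label v x = 1) ?mulg1 //.
  rewrite /edge_label insubN //; apply/negP => /asboolP[/= _ _].
  by rewrite base_point_transversal // deck_transversal.
have PF : (P \o ev) =1 id.
  apply: pg_morph_ext => //.
    by move=> x y /=; rewrite evM PM //; exact: ev_sub.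
  move=> p /=; rewrite /ev pg_lift_gen /basis_elt.
  case: (p) => -[v s] /= pl; case/asboolP: (pl) => /= ts Ts _.
  have [Hc Tc] := deckP (s * vtx v).
  have : P (s * vtx v) = P (deck (s * vtx v)).
    by rewrite -[in LHS](mulVKg (deck (s * vtx v)) (s * vtx v)) PM // (Ptrans _ Tc) mulg1.
  move=> <-; rewrite Pedge // Ptrans // mul1g /edge_label base_point_transversal //.
  by rewrite insubT.
split; first by apply: (can_inj (g := P)) => a; exact: PF.
apply/seteqP; split=> [_ [a _ <-]|h Hh]; first exact: ev_sub.
by exists (P h) => //; exact: etrans (FP h) (deck_sub Hh).
Qed.

End Free.

(** * Freely irreducible groups have connected graphs *)

Lemma word_val3 (X : choiceType) (G : groupType) (phi : X -> G) x y z :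
  word_val phi [:: (x, false); (y, false); (z, true)] = phi x * phi y * (phi z)^-1.
Proof. by rewrite !word_val_cons word_val_nil mulg1 /letter_val /= mulgA. Qed.

Lemma word_val_commutator (X : choiceType) (G : groupType) (phi : X -> G) x y :
  commute (phi x) (phi y) ->
  word_val phi [:: (x, true); (y, true); (x, false); (y, false)] = 1.
Proof.
move=> xy; rewrite !word_val_cons word_val_nil mulg1 /letter_val /=.
by rewrite xy mulgA -invgM mulVg.
Qed.

Section FreeProduct.
Variables (A B : groupType).

Definition injl (a : A) : free_product A B := pg_gen (@free_product_relators A B) (inl a).
Definition injr (b : B) : free_product A B := pg_gen (@free_product_relators A B) (inr b).

Lemma free_product_relator r : free_product_relators r ->
  word_val (@pg_gen _ (@free_product_relators A B)) r = 1.
Proof.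
move=> Rr; rewrite -pg_class_val; apply/pg_classP.
by rewrite -[X in word_eq _ X _]cats0; exact: (word_eq_relator [::] [::] Rr).
Qed.

Lemma injlM : {morph injl : a a' / a * a'}.
Proof.
move=> a a'; apply/esym/divg1_eq; rewrite /injl -word_val3.
by apply: free_product_relator; left; exists a, a'.
Qed.

Lemma injrM : {morph injr : b b' / b * b'}.
Proof.
move=> b b'; apply/esym/divg1_eq; rewrite /injr -word_val3.
by apply: free_product_relator; right; exists b, b'.
Qed.

End FreeProduct.

Section Subgraph.
Variables (V : finType) (e : simple_graph V) (P : pred V).

Definition sub_adj : rel {v | P v} := fun x y => e (val x) (val y).

Lemma sub_adj_sym : symmetric sub_adj.
Proof. by move=> x y; rewrite /sub_adj adj_sym. Qed.

Lemma sub_adj_irr : irreflexive sub_adj.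
Proof. by move=> x; rewrite /sub_adj adj_irr. Qed.

Definition subgraph := SimpleGraph sub_adj_sym sub_adj_irr.

Lemma sub_relator r : raag_relators sub_adj r ->
  word_val (fun x => raag_gen e (val x)) r = 1.
Proof.
case=> x [y [xy ->]]; apply: word_val_commutator.
exact: (@commute_letter _ e (val x) (val y) false false xy).
Qed.

Definition sub_incl : raag sub_adj -> raag e := pg_lift sub_relator.

Lemma sub_inclM : {morph sub_incl : x y / x * y}.
Proof. exact: pg_liftM. Qed.

Lemma sub_incl_gen x : sub_incl (raag_gen sub_adj x) = raag_gen e (val x).
Proof. exact: pg_lift_gen. Qed.

Lemma sub_nontrivial v : P v -> nontrivial (raag sub_adj).
Proof. by move=> Pv; exists (raag_gen sub_adj (Sub v Pv)); exact: (@gen_neq1 _ subgraph). Qed.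

End Subgraph.

Arguments sub_adj {V} e P x y.

Section Disconnected.
Variables (V : finType) (e : simple_graph V) (P : pred V).
Hypothesis P_closed : forall u v, e u v -> P u = P v.

Let A := raag (sub_adj e P).
Let B := raag (sub_adj e (predC P)).

Definition factor_val (x : A + B) : raag e :=
  match x with inl a => sub_incl a | inr b => sub_incl b end.

Lemma factor_relator r : @free_product_relators A B r -> word_val factor_val r = 1.
Proof.
by case=> [[a [a' ->]]|[b [b' ->]]]; rewrite word_val3 /= sub_inclM mulgV.
Qed.

Definition of_free_product : free_product A B -> raag e := pg_lift factor_relator.

Definition vertex_val (v : V) : free_product A B :=
  if insub v is Some x then injl B (raag_gen (sub_adj e P) x)
  else if insub v is Some y then injr A (raag_gen (sub_adj e (predC P)) y)
  else 1.

Lemma vertex_val_in v (Pv : P v) :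
  vertex_val v = injl B (raag_gen (sub_adj e P) (Sub v Pv)).
Proof. by rewrite /vertex_val insubT. Qed.

Lemma vertex_val_out v (nPv : predC P v) :
  vertex_val v = injr A (raag_gen (sub_adj e (predC P)) (Sub v nPv)).
Proof. by rewrite /vertex_val insubN ?insubT. Qed.

Lemma vertex_relator r : raag_relators e r -> word_val vertex_val r = 1.
Proof.
case=> u [v [uv ->]]; apply: word_val_commutator.
have := P_closed uv; case Pu: (P u) => Pv.
  have Pv' : P v by rewrite -Pv.
  rewrite (vertex_val_in Pu) (vertex_val_in Pv') /commute -!injlM; congr injl.
  exact: (@commute_letter _ (subgraph e P) (Sub u Pu) (Sub v Pv') false false).
have nPu : predC P u by rewrite /= Pu.
have nPv : predC P v by rewrite /= -Pv.
rewrite (vertex_val_out nPu) (vertex_val_out nPv) /commute -!injrM; congr injr.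
exact: (@commute_letter _ (subgraph e (predC P)) (Sub u nPu) (Sub v nPv) false false).
Qed.

Definition to_free_product : raag e -> free_product A B := pg_lift vertex_relator.

Lemma of_to : cancel to_free_product of_free_product.
Proof.
have tM : {morph to_free_product : x y / x * y} by exact: pg_liftM.
have oM : {morph of_free_product : x y / x * y} by exact: pg_liftM.
apply: (@pg_morph_ext _ _ _ (of_free_product \o to_free_product) id) => //.
  by move=> x y /=; rewrite tM oM.
move=> v; rewrite /= [to_free_product _]pg_lift_gen.
have [Pv|nPv] := boolP (P v).
  by rewrite (vertex_val_in Pv) [of_free_product _]pg_lift_gen /= sub_incl_gen.
by rewrite (vertex_val_out nPv) [of_free_product _]pg_lift_gen /= sub_incl_gen.
Qed.

Lemma to_of : cancel of_free_product to_free_product.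
Proof.
have tM : {morph to_free_product : x y / x * y} by exact: pg_liftM.
have oM : {morph of_free_product : x y / x * y} by exact: pg_liftM.
apply: (@pg_morph_ext _ _ _ (to_free_product \o of_free_product) id) => //.
  by move=> x y /=; rewrite oM tM.
case=> x; rewrite /= [of_free_product _]pg_lift_gen /=.
  apply: (@pg_morph_ext _ _ _ (to_free_product \o @sub_incl _ e P) (@injl A B)).
  - by move=> y z /=; rewrite sub_inclM tM.
  - exact: injlM.
  move=> v; rewrite /= sub_incl_gen [to_free_product _]pg_lift_gen.
  by rewrite (vertex_val_in (valP v)); congr (injl _ (raag_gen _ _)); apply: val_inj.
apply: (@pg_morph_ext _ _ _ (to_free_product \o @sub_incl _ e (predC P)) (@injr A B)).
- by move=> y z /=; rewrite sub_inclM tM.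
- exact: injrM.
move=> v; rewrite /= sub_incl_gen [to_free_product _]pg_lift_gen.
by rewrite (vertex_val_out (valP v)); congr (injr _ (raag_gen _ _)); apply: val_inj.
Qed.

Lemma free_product_splitting u v : P u -> ~~ P v -> ~ freely_irreducible (raag e).
Proof.
move=> Pu nPv; apply; exists A, B; split.
- exact: sub_nontrivial Pu.
- exact: (@sub_nontrivial _ e (predC P) v).
exists (pg_lift factor_relator); exists to_free_product; [exact: to_of|exact: of_to].
Qed.

End Disconnected.

(** The vertices of a connected component and the remaining ones generate free
    factors. *)
Lemma irreducible_connected (V : finType) (e : simple_graph V) :
  freely_irreducible (raag e) -> forall u v, connect e u v.
Proof.
move=> irr u v; apply/negPn/negP => nuv.
apply: (@free_product_splitting V e (connect e u) _ u v) => // x y xy.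
by rewrite (same_connect1r (sym_connect_sym (@adj_sym _ e)) xy).
Qed.

(** * Distances in Cayley graphs *)

Section CayleyPaths.
Variables (R : realType) (G : groupType) (S : set G).
Hypothesis S_gen : generates S.
Implicit Types (g h x y : G) (p : seq G).

Lemma cayley_adjP g h : reflect (exists2 s, S s & h = g * s \/ g = h * s) (cayley_adj S g h).
Proof. exact: asboolP. Qed.

Lemma cayley_adjMl x g h : cayley_adj S (x * g) (x * h) = cayley_adj S g h.
Proof.
apply/cayley_adjP/cayley_adjP => -[s Ss gh]; exists s => //.
  by case: gh => gh; [left|right]; apply: (mulgI x); rewrite mulgA.
by case: gh => ->; [left|right]; rewrite mulgA.
Qed.

Lemma cayley_adjC g h : cayley_adj S g h = cayley_adj S h g.
Proof.
by apply/cayley_adjP/cayley_adjP => -[s Ss [gh|gh]]; exists s => //; [right|left|right|left].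
Qed.

Definition joined n g h := exists p, [/\ path (cayley_adj S) g p, last g p = h & size p = n].

Lemma joined0 g : joined 0 g g.
Proof. by exists [::]. Qed.

Lemma joined_cat m n g h k : joined m g h -> joined n h k -> joined (m + n) g k.
Proof.
move=> [p [pp <- <-]] [q [qp <- <-]]; exists (p ++ q).
by rewrite cat_path last_cat size_cat pp.
Qed.

Lemma joinedC n g h : joined n g h -> joined n h g.
Proof.
move=> [p [pp <- <-]]; exists (rev (belast g p)); split.
- rewrite rev_path (@eq_path _ _ (cayley_adj S)) // => x y.
  exact: cayley_adjC.
- by case: p {pp} => //= a p; rewrite rev_cons last_rcons.
- by rewrite size_rev size_belast.
Qed.

Lemma joinedMl n x g h : joined n g h -> joined n (x * g) (x * h).
Proof.
move=> [p [pp <- <-]]; exists [seq x * y | y <- p]; split.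
- rewrite path_map (@eq_path _ _ (cayley_adj S)) // => y z /=.
  exact: cayley_adjMl.
- exact: last_map.
- exact: size_map.
Qed.

Lemma joined_all g h : exists n, joined n g h.
Proof.
have sub : is_subgroup [set x | exists n, joined n 1 x].
  split; first by exists 0%N; exact: joined0.
  move=> x y /= [m xm] [n yn]; exists (m + n)%N; apply: joined_cat xm _.
  have := joinedMl (x * y^-1) (joinedC yn).
  by rewrite mulgVK mulg1.
have gens : S `<=` [set x | exists n, joined n 1 x].
  move=> s Ss; exists 1%N, [:: s]; split=> //=; rewrite andbT.
  by apply/cayley_adjP; exists s => //; left; rewrite mul1g.
have := S_gen sub gens => all.
have : [set x | exists n, joined n 1 x] (g^-1 * h) by rewrite all.
move=> [n] /(joinedMl g); rewrite mulg1 mulVKg => jn; by exists n.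
Qed.

Lemma graph_distP g h : exists n, [/\ graph_dist R S g h = (n%:R)%R, joined n g h &
  forall m, joined m g h -> (n <= m)%N].
Proof.
have ex : exists n, `[< joined n g h >].
  by have [n jn] := joined_all g h; exists n; exact/asboolP.
case: (ex_minnP ex) => n /asboolP jn nmin; exists n; split=> //; last first.
  by move=> m jm; apply: nmin; exact/asboolP.
rewrite /graph_dist; set E := (X in inf X).
have lb : lbound E (n%:R)%R.
  move=> _ [p [pp pl] <-]; rewrite ler_nat; apply: nmin; apply/asboolP.
  by exists p.
have En : E (n%:R)%R by have [p [pp pl ps]] := jn; exists p; [split|rewrite ps].
apply/eqP; rewrite eq_le; apply/andP; split; last by apply: lb_le_inf => //; exists (n%:R)%R.
by apply: ge_inf => //; exists (n%:R)%R.
Qed.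

Lemma graph_dist_ge0 g h : (0 <= graph_dist R S g h)%R.
Proof. by have [n [-> _ _]] := graph_distP g h; exact: ler0n. Qed.

Lemma graph_distMl x g h : graph_dist R S (x * g) (x * h) = graph_dist R S g h.
Proof.
have [n [-> jn nmin]] := graph_distP g h.
have [m [-> jm mmin]] := graph_distP (x * g) (x * h).
congr (_%:R)%R; apply/eqP; rewrite eqn_leq mmin; last exact: joinedMl.
by rewrite nmin //; have := joinedMl x^-1 jm; rewrite !mulKg.
Qed.

Lemma cayley_dist_vertex g h :
  cayley_dist R S (Vertex R S g) (Vertex R S h) = graph_dist R S g h.
Proof.
rewrite /cayley_dist /= (_ : _ `|` _ = [set graph_dist R S g h]) ?inf1 //.
apply/seteqP; split=> [r [[_ -> [_ -> <-]]|//]|r ->] /=; first by rewrite add0r addr0.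
by left; exists (g, 0%R) => //; exists (h, 0%R) => //=; rewrite add0r addr0.
Qed.

(** A vertex at distance at most 1, the initial point of the edge. *)
Definition vertex_near (p : cayley_graph R S) : G :=
  match p with Vertex g => g | EdgePoint g _ _ => g end.

Lemma graph_dist_triangle h g k :
  (graph_dist R S g k <= graph_dist R S g h + graph_dist R S h k)%R.
Proof.
have [n [-> jn _]] := graph_distP g h; have [m [-> jm _]] := graph_distP h k.
have [l [-> _ lmin]] := graph_distP g k.
by rewrite -natrD ler_nat lmin //; exact: joined_cat jn jm.
Qed.

Lemma graph_dist_adj g s : S s -> (graph_dist R S g (g * s) <= 1)%R.
Proof.
move=> Ss; have [n [-> _ nmin]] := graph_distP g (g * s).
rewrite (ler_nat R n 1) nmin //; exists [:: g * s]; split=> //=; rewrite andbT.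
by apply/cayley_adjP; exists s => //; left.
Qed.

Lemma graph_distC g h : graph_dist R S g h = graph_dist R S h g.
Proof.
have [n [-> jn nmin]] := graph_distP g h; have [m [-> jm mmin]] := graph_distP h g.
by congr (_%:R)%R; apply/eqP; rewrite eqn_leq nmin ?mmin //; exact: joinedC.
Qed.

Lemma edge_endsP (p : cayley_graph R S) a : edge_ends p a ->
  (0 <= a.2)%R /\ (graph_dist R S (vertex_near p) a.1 <= 1)%R.
Proof.
have d0 g : graph_dist R S g g = 0%R.
  have [n [-> _ nmin]] := graph_distP g g.
  by have := nmin 0%N (joined0 g); rewrite leqn0 => /eqP ->.
case: p => [g -> /=|g s t [->|->] /=]; rewrite ?d0; split; rewrite ?ler01 ?subr_ge0 //.
by apply: graph_dist_adj; exact: svalP.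
Qed.

Lemma edge_ends_near (p : cayley_graph R S) :
  exists2 a, edge_ends p a & a.1 = vertex_near p /\ (a.2 <= 1)%R.
Proof.
case: p => [g|g s t] /=; first by exists (g, 0%R).
exists (g, (t%:num)%R); first by left.
by split=> //; rewrite /=; exact: le1.
Qed.

Lemma cayley_dist_le (p q : cayley_graph R S) :
  (cayley_dist R S p q <= graph_dist R S (vertex_near p) (vertex_near q) + 2)%R.
Proof.
have [a pa [a1 a2]] := edge_ends_near p; have [b qb [b1 b2]] := edge_ends_near q.
apply: (@le_trans _ _ (a.2 + graph_dist R S a.1 b.1 + b.2)%R); last first.
  by rewrite a1 b1; lra.
apply: ge_inf; last by left; exists a => //; exists b.
exists 0%R => r [[a' pa' [b' qb' <-]]|].
  have [? _] := edge_endsP pa'; have [? _] := edge_endsP qb'.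
  by have := graph_dist_ge0 a'.1 b'.1; lra.
by case: (p) (q) => [g|g s t] [h|h s' t'] //= [_ _ ->].
Qed.

Lemma cayley_dist_ge (p q : cayley_graph R S) :
  (graph_dist R S (vertex_near p) (vertex_near q) - 2 <= cayley_dist R S p q)%R.
Proof.
apply: lb_le_inf => [|r].
  have [a pa _] := edge_ends_near p; have [b qb _] := edge_ends_near q.
  by exists (a.2 + graph_dist R S a.1 b.1 + b.2)%R; left; exists a => //; exists b.
case=> [[a pa [b qb <-]]|].
  have [? ?] := edge_endsP pa; have [? ?] := edge_endsP qb.
  have := graph_dist_triangle a.1 (vertex_near p) (vertex_near q).
  have := graph_dist_triangle b.1 a.1 (vertex_near q).
  rewrite (graph_distC b.1); lra.
case: p q => [g|g s t] [h|h s' t'] //= [-> _ ->].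
have [n [-> _ nmin]] := graph_distP h h.
have := nmin 0%N (joined0 h); rewrite leqn0 => /eqP ->.
by apply: (@le_trans _ _ 0%R); [lra|exact: normr_ge0].
Qed.

Lemma edge_ends_act x (p : cayley_graph R S) :
  edge_ends (cayley_act R S x p) = [set (x * a.1, a.2) | a in edge_ends p].
Proof.
apply/seteqP; case: p => [g|g s t] /=; split=> a.
- by move=> ->; exists (g, 0%R).
- by move=> [_ -> <-].
- by move=> [->|->]; [exists (g, (t%:num)%R); [left|]|
    exists (g * sval s, (1 - t%:num)%R); [right|rewrite /= mulgA]].
- by move=> [_ [->|->] <-]; [left|right; rewrite /= mulgA].
Qed.

Lemma cayley_act_isometry x (p q : cayley_graph R S) :
  cayley_dist R S (cayley_act R S x p) (cayley_act R S x q) = cayley_dist R S p q.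
Proof.
rewrite /cayley_dist !edge_ends_act; congr (inf (_ `|` _)); last first.
  case: p q => [g|g s t] [h|h s' t'] //=; apply/seteqP; split=> r [gh ss' ->].
    by split=> //; exact: mulgI gh.
  by split=> //; rewrite gh.
apply/seteqP; split=> r.
  move=> [_ [a pa <-] [_ [b qb <-] <-]] /=; exists a => //; exists b => //.
  by rewrite graph_distMl.
move=> [a pa [b qb <-]]; exists (x * a.1, a.2); first by exists a.
exists (x * b.1, b.2); first by exists b.
by rewrite /= graph_distMl.
Qed.

End CayleyPaths.

(** * Word metrics and Cayley graphs of right-angled Artin groups *)

Section WordMetric.
Variables (R : realType) (V : finType) (e : rel V).
Implicit Types (g h x y : raag e) (S : set (raag e)).

Lemma raag_gens_generate : generates (raag_gens e).
Proof.
move=> K Ks sub; apply/seteqP; split=> // g _; have [w <-] := el_surj g.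
have KV x : K x -> K x^-1 by move=> Kx; rewrite -div1g; apply: Ks.2 => //; exact: Ks.1.
elim: w => [|[v b] w IH]; first exact: Ks.1.
have Kv : K (raag_gen e v) by apply: sub; exists v.
rewrite el_cons -[el w]invgK; apply: Ks.2; last exact: KV.
by rewrite el_letter; case: b => //; exact: KV.
Qed.

Lemma dist_joined S C n g h : (forall s, S s -> (len s <= C)%N) ->
  joined S n g h -> (dist g h <= C * n)%N.
Proof.
move=> SC [p [+ <- <-]]; elim: p g => [|x p IH] g /=; first by rewrite dist_xx.
case/andP=> /cayley_adjP [s /SC sC gx] /IH; rewrite mulnS => le.
apply: leq_trans (dist_triangle x _ _) (leq_add _ le).
by case: gx => ->; [|rewrite distC]; rewrite -[X in dist X _]mulg1 distMl dist1.
Qed.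

Lemma joined_dist S C : (forall v, exists2 n, (n <= C)%N & joined S n 1 (raag_gen e v)) ->
  forall g h, exists2 n, (n <= C * dist g h)%N & joined S n g h.
Proof.
move=> SC g h; rewrite /dist -{2}(mulVKg g h).
have [w <- <-] := geodesic_word (g^-1 * h).
elim: w g => [|[v b] w IH] g; first by exists 0%N; rewrite ?mulg1 //; exact: joined0.
have [n nC jn] := SC v.
have [m mC jm] := IH (g * el [:: (v, b)]).
exists (n + m)%N; first by rewrite mulnS leq_add.
rewrite el_cons mulgA; apply: joined_cat jm.
rewrite el_letter; case: b {IH}; last by have := joinedMl g jn; rewrite mulg1.
by have := joinedMl (g * (raag_gen e v)^-1) (joinedC jn); rewrite mulgVK mulg1.
Qed.

Lemma graph_dist_gens g h : graph_dist R (raag_gens e) g h = ((dist g h)%:R)%R.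
Proof.
have [n [-> jn nmin]] := graph_distP R raag_gens_generate g h; congr (_%:R)%R.
apply/eqP; rewrite eqn_leq; apply/andP; split.
  have [|m mle jm] := @joined_dist (raag_gens e) 1 _ g h.
    move=> v; exists 1%N => //; exists [:: raag_gen e v]; split=> //=; rewrite andbT.
    by apply/cayley_adjP; exists (raag_gen e v); [exists v|left; rewrite mul1g].
  by rewrite -[dist g h]mul1n (leq_trans _ mle) // nmin.
rewrite -[n]mul1n; apply: dist_joined jn => _ [v _ <-].
by rewrite -el_gen len_letter.
Qed.

(** A finite generating set defines distances comparable with word length. *)
Lemma graph_dist_comparison S : finite_set S -> generates S ->
  exists C : nat, forall g h,
    ((dist g h)%:R <= C%:R * graph_dist R S g h)%R /\
    (graph_dist R S g h <= C%:R * (dist g h)%:R)%R.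
Proof.
move=> /finite_seqP [s sE] Sgen.
have up x : S x -> (len x <= \max_(y <- s) len y)%N.
  by rewrite sE => xs; exact: leq_bigmax_seq.
have [f fP] := choice (fun v => joined_all Sgen 1 (raag_gen e v)).
pose C := maxn (\max_(y <- s) len y) (\max_v f v).
exists C => g h; have [n [-> jn nmin]] := graph_distP R Sgen g h.
split; rewrite -natrM ler_nat.
  apply: leq_trans (dist_joined up jn) _; rewrite leq_mul2r; apply/orP; right.
  exact: leq_maxl.
have [|m mle jm] := @joined_dist S C _ g h; last exact: leq_trans (nmin _ jm) mle.
move=> v; exists (f v) => //; apply: leq_trans (leq_maxr _ _).
exact: (leq_bigmax v).
Qed.

End WordMetric.

Section DiscreteMorse.
Local Open Scope ring_scope.
Variables (R : realType) (V : finType) (e : simple_graph V).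

(** A discrete quasigeodesic becomes a quasigeodesic with real parameter by
    rounding the parameter down. *)
Lemma morse_discrete (H : set (raag e)) : morse_subgroup R H -> discrete_morse H.
Proof.
move=> [S [Sfin Sgen Sm]] A.
have [C cmp] := graph_dist_comparison R Sfin Sgen.
pose a : R := A%:R; pose c0 : R := C%:R.
have a0 : 0 <= a by exact: ler0n.
have c00 : 0 <= c0 by exact: ler0n.
have ac0 : 0 <= a * c0 by exact: mulr_ge0.
(* Rounding changes the parameter by less than 1, and [c0] compares the two
   word metrics. *)
pose A' : R := a * c0 + 1; pose B' : R := 2 * (a * c0) + a + 1.
have A'0 : 0 < A' by rewrite /A'; lra.
have B'0 : 0 <= B' by rewrite /B'; lra.
have [K K0 KP] := Sm A' B' A'0 B'0.
exists (C * (Num.truncn K))%N => n c cq Hc0 Hcn i ni.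
pose f (t : R) : cayley_graph R S := Vertex R S (c (Num.truncn t)).
have dE s t : cayley_dist R S (f s) (f t) =
    graph_dist R S (c (Num.truncn s)) (c (Num.truncn t)).
  exact: cayley_dist_vertex.
have quasi s t : 0 <= s -> s <= t -> t <= n%:R ->
    A'^-1 * (t - s) - B' <= cayley_dist R S (f s) (f t) <= A' * (t - s) + B'.
  move=> s0 st tn; have t0 : 0 <= t by exact: le_trans st.
  have /andP[s1 s2] := truncn_itv s0; have /andP[t1 t2] := truncn_itv t0.
  rewrite dE; move: s1 s2 t1 t2.
  have : (Num.truncn s <= Num.truncn t)%N by exact: le_truncn.
  have : (Num.truncn t <= n)%N by rewrite -[n](@natrK R); exact: le_truncn.
  move: (Num.truncn s) (Num.truncn t) => i' j' jn ij s1 s2 t1 t2.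
  have [|u l] := cq i' (j' - i')%N; first by rewrite subnKC.
  move: u l; rewrite subnKC // => u l.
  have [d1 d2] := cmp (c i') (c j'); have D0 := graph_dist_ge0 R Sgen (c i') (c j').
  move: u l; rewrite -!(ler_nat R) !natrD !natrM natrB //.
  move: (dist _ _)%:R d1 d2 => d; move: (graph_dist _ _ _ _) D0 => D D0 d1 d2.
  rewrite -addn1 natrD in s2; rewrite -addn1 natrD in t2.
  rewrite -/a -/c0 in d1 d2 *; move: (i'%:R) (j'%:R) s1 s2 t1 t2 => k l s1 s2 t1 t2 u lo.
  have cd : c0 * d <= c0 * (a * (l - k) + a) by exact: ler_wpM2l.
  have ad : a * d <= a * (c0 * D) by exact: ler_wpM2l.
  have h1 : (a * c0) * (l - k) <= (a * c0) * (t - s + 1) by apply: ler_wpM2l => //; lra.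
  apply/andP; split; last by rewrite /A' /B'; lra.
  rewrite lerBlDr ler_pdivrMl // /A' /B'.
  have : 0 <= a * c0 * (a * c0) by exact: mulr_ge0.
  have : 0 <= a * c0 * a by exact: mulr_ge0.
  have : 0 <= a * c0 * D by exact: mulr_ge0.
  lra.
have quasi' : quasigeodesic (cayley_dist R S) A' B' 0 n%:R f.
  split=> [|s t /andP[s0 sn] /andP[t0 tn]]; first exact: ler0n.
  have [st|/ltW ts] := leP s t.
    by rewrite distrC ger0_norm ?subr_ge0 //; have /andP := quasi s t s0 st tn.
  rewrite ger0_norm ?subr_ge0 // dE graph_distC // -dE.
  by have /andP := quasi t s t0 ts sn.
have [|||h] := KP _ _ _ quasi' _ _ i%:R.
- by exists (c 0%N); rewrite // /f truncn0.
- by exists (c n); rewrite // /f natrK.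
- by rewrite ler0n ler_nat.
case=> h' Hh' <-; rewrite cayley_dist_vertex // natrK => dK.
exists h' => //; have [d1 _] := cmp (c i) h'.
have [m [mE _ _]] := graph_distP R Sgen (c i) h'; rewrite mE in dK d1.
rewrite -natrM ler_nat in d1; apply: leq_trans d1 _; rewrite leq_mul2l.
by apply/orP; right; rewrite truncn_ge_nat.
Qed.

End DiscreteMorse.

(** * The dichotomy for Morse subgroups *)

Section Dichotomy.
Variables (R : realType) (V : finType) (e : simple_graph V).
Implicit Types (g h k c x y : raag e) (H : set (raag e)).

Let S := raag_gens e.
Let S_gen : generates S := @raag_gens_generate V e.

Lemma axis_displacement c J N m n : strong_axis c J N ->
  (`|m - n|%N <= dist (zpow c m) (zpow c n))%N /\
  (dist (zpow c m) (zpow c n) <= `|m - n|%N * len c)%N.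
Proof.
move=> sa; wlog mn : m n / (m <= n)%R.
  move=> wl; have [mn|/ltW nm] := leP m n; first exact: wl.
  by rewrite distnC distC; exact: wl.
have nE : n = (m + Posz `|m - n|%N)%R by lia.
split; last by rewrite {1}nE dist_axis.
apply: (many_sep (s := m) sa) => r mr rn; rewrite (sep_axis sa) //.
by rewrite mr [X in (_ < X)%R]nE rn.
Qed.

(** The contraction is proved for vertices; every point is within distance 1 of
    its vertex [vertex_near], at the price of the slack in [nearly_nearest]. *)
Lemma strong_axis_isometry c J N k : strong_axis c J N ->
  contracting_isometry (cayley_dist R S) (cayley_act R S) (k * c * k^-1).
Proof.
move=> sa; split; first by move=> p q; exact: cayley_act_isometry.
pose orb n : cayley_graph R S := Vertex R S (k * zpow c n).
have orbE n : cayley_act R S (zpow (k * c * k^-1) n) (Vertex R S k) = orb n.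
  by rewrite /= zpow_conj mulgVK.
have dE g g' : cayley_dist R S (Vertex R S g) (Vertex R S g') = ((dist g g')%:R)%R.
  by rewrite cayley_dist_vertex // graph_dist_gens.
have orb_dist m n : cayley_dist R S (orb m) (orb n) = ((dist (zpow c m) (zpow c n))%:R)%R.
  by rewrite dE distMl.
exists (Vertex R S k); split.
  have : (0 <= (len c)%:R :> R)%R by exact: ler0n.
  have : (len c)%:R%R = (len c)%:R%R :> R by [].
  move: {2 3}((len c)%:R)%R => L LE l0.
  have L1 : (0 < L + 1)%R by lra.
  exists (L + 1)%R, 0%R; split=> // m n _ _; rewrite !orbE orb_dist.
  have [lo up] := axis_displacement m n sa.
  have -> : (`|(m - n)%:~R| = (`|m - n|%N)%:R :> R)%R.
    by rewrite -intr_norm natr_absz.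
  rewrite -(ler_nat R) in lo; rewrite -(ler_nat R) natrM LE in up.
  have d0 : (0 <= (`|m - n|%N)%:R :> R)%R by exact: ler0n.
  move: ((dist _ _)%:R)%R lo up => D lo up.
  move: ((absz _)%:R)%R d0 lo up => d d0 lo up.
  have Ld : (0 <= L * d)%R by exact: mulr_ge0.
  split; last by lra.
  by rewrite subr0; apply: le_trans lo; rewrite ler_pdivrMl //; lra.
have [D DP] := strong_axis_contracting sa.
exists (D%:R)%R; first exact: ler0n.
move=> p r disj q q' y y' pq pq' [[m _ <-] ny] [[m' _ <-] ny'].
rewrite !orbE orb_dist ler_nat leqNgt; apply/negP => Dlt.
pose v (p : cayley_graph R S) : raag e := k^-1 * vertex_near p.
have vE p1 n : dist (v p1) (zpow c n) = dist (vertex_near p1) (k * zpow c n).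
  by rewrite -(distMl k) /v mulVKg.
have approx p1 n : (cayley_dist R S p1 (orb n) <= (dist (v p1) (zpow c n))%:R + 2)%R /\
    ((dist (v p1) (zpow c n))%:R - 2 <= cayley_dist R S p1 (orb n))%R.
  have := cayley_dist_le S_gen p1 (orb n); have := cayley_dist_ge S_gen p1 (orb n).
  by rewrite /= graph_dist_gens vE.
have near q0 n0 : nearest_points (cayley_dist R S)
    [set cayley_act R S (zpow (k * c * k^-1) n) (Vertex R S k) | n in setT] q0 (orb n0) ->
    nearly_nearest c (v q0) n0.
  move=> [_ nq] n; rewrite -(ler_nat R) natrD.
  have [_ l1] := approx q0 n0; have [u2 _] := approx q0 n.
  have := nq (orb n) (ex_intro2 _ _ n I (orbE n)); lra.
have nq : nearly_nearest c (v q) m.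
  by apply: near; rewrite -orbE; split=> //; exists m.
have nq' : nearly_nearest c (v q') m'.
  by apply: near; rewrite -orbE; split=> //; exists m'.
have close q0 n : (cayley_dist R S p q0 <= r)%R ->
    (dist (v p) (zpow c n) + 4 <= dist (v p) (v q0))%N -> False.
  move=> pq0; rewrite -(ler_nat R) natrD => le.
  apply: (disj (orb n)); last by exists n.
  have [u _] := approx p n.
  have := cayley_dist_ge S_gen p q0; rewrite graph_dist_gens -(distMl k^-1) -/(v p) -/(v q0).
  lra.
by have [n [|]] := DP (v p) (v q) (v q') m m' nq nq' Dlt; exact: close.
Qed.

Hypothesis e_conn : forall u v, connect e u v.

(** The planes spanned by [c1] and [c2], then by [c1] and [u], put a power of the
    vertex [u] into the conjugate of H. *)
Lemma join_finite_index H k (S1 S2 : pred V) u c1 c2 : is_subgroup H -> discrete_morse H ->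
  (forall v v', S1 v -> S2 v' -> e v v') -> (forall v, S1 v -> e v u) ->
  parab S1 c1 -> parab S2 c2 -> c1 <> 1 -> conjugate_set k H (c1 * c2) ->
  finite_index H.
Proof.
move=> Hs Hm S12 S1u p1 p2 c1n Hc.
have Hs' := subgroup_conj k Hs; have Hm' := morse_conj k Hm.
have [p p0 Hp] : exists2 p, (0 < p)%N & conjugate_set k H (c1 ^+ p).
  have [c2E|c2n] := pselect (c2 = 1).
    by exists 1%N => //; rewrite expg1 -[c1]mulg1 -c2E.
  exact: (flat_diagonal S12 p1 p2 c1n c2n Hs' Hm' Hc).
have cp1 : c1 ^+ p <> 1.
  by move=> h; have := len_power_ge p c1n; rewrite h len1 leqNgt p0.
have pu : parab (pred1 u) (raag_gen e u).
  by apply: (@parab_letter _ e _ (u, false)); exact: eqxx.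
have S1u' v v' : S1 v -> pred1 u v' -> e v v' by move=> /S1u + /eqP ->.
have [q q0 Hq] := flat_left S1u' (parabX p p1) pu cp1 (@gen_neq1 _ e u) Hs' Hm' Hp.
exact: (morse_finite_index e_conn Hs Hm q0 Hq).
Qed.

Theorem morse_dichotomy H : is_subgroup H -> discrete_morse H -> ~ finite_index H ->
  is_free_subgroup H /\
  forall h, H h -> h <> 1 -> contracting_isometry (cayley_dist R S) (cayley_act R S) h.
Proof.
move=> Hs Hm nfin; split.
  apply: (@free_of_trivial_intersections V e H Hs) => v g x px Hx.
  have [//|x1] := pselect (x = 1); case: nfin.
  apply: (@join_finite_index H g (e v) pred0 v x 1) => //; last by rewrite mulg1.
    by move=> u; rewrite adj_sym.
  exact: parab1.
move=> h Hh h1; have [k [c [cmin hE]]] := conj_minimalP h.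
have c1 : c <> 1 by move=> c1; apply: h1; rewrite hE c1 mulg1 mulgV.
have [[S1 [S2 [u [d1 [d2 [S12 S1u [p1 p2] cE d1n]]]]]]|[J [N sa]]] := minimal_dichotomy cmin c1.
  case: nfin; apply: (@join_finite_index H k S1 S2 u d1 d2) => //.
  by rewrite /conjugate_set /= -cE -hE.
by rewrite hE; exact: strong_axis_isometry sa.
Qed.

End Dichotomy.

Theorem theoremB1 (R : realType) (V : finType) (e : rel V)
    (e_sym : symmetric e) (e_irr : irreflexive e)
    (A_irr : freely_irreducible (raag e))
    (H : set (raag e)) (H_sub : is_subgroup H) (H_morse : morse_subgroup R H) :
  finite_index H \/
  (is_free_subgroup H /\
   forall h : raag e, H h -> h <> 1%g ->
     contracting_isometry (cayley_dist R (raag_gens e))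
       (cayley_act R (raag_gens e)) h).
Proof.
have [fin|nfin] := pselect (finite_index H); [by left|right].
pose G := SimpleGraph e_sym e_irr.
have conn : forall u v, connect G u v by exact: irreducible_connected.
exact: (morse_dichotomy R conn H_sub (@morse_discrete R V G H H_morse) nfin).
Qed.
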